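(* Let $d\ge 1$, let $G$ be a finite group of linear isometries of $\mathbb{R}^d$, and let $\theta^*\in\mathbb{R}^d$. The Fisher information $I(\theta^* )=-\mathrm{d}^2\Psi(\theta^* )$, where $\Psi(\theta)=\mathbb{E}_{\theta^*}[\log L(Y,\theta)]$, is (positive) definite if and only if the vectors $g\theta^*$, $g\in G$ (the centers of the mixture $\mathbb{P}_{\theta^*}$), are pairwise distinct.
   Context: For $\theta\in\mathbb{R}^d$, $\mathbb{P}_\theta=\frac{1}{|G|}\sum_{g\in G}\mathcal{N}(g\theta,I)$ is the uniform mixture of Gaussian distributions with means $g\theta$, $g\in G$, and identity covariance matrix. Its density with respect to the Lebesgue measure is $L(y,\theta)=\frac{1}{|G|(2\pi)^{d/2}}\sum_{g\in G}e^{-\frac12\|y-g\theta\|^2}$, where $\|\cdot\|$ is the Euclidean norm. $\mathbb{E}_{\theta^*}$ denotes expectation when $Y\sim\mathbb{P}_{\theta^*}$, and $\mathrm{d}^2\Psi(\theta^* )$ is the Hessian of $\Psi$ at $\theta^*$. *)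

(* Defs.v *)
From HB Require Import structures.
From mathcomp Require Import all_boot all_order all_algebra.
From mathcomp Require Import finmap.
From mathcomp Require Import all_classical all_reals all_analysis.

Set Implicit Arguments.
Unset Strict Implicit.
Unset Printing Implicit Defensive.
Import Order.TTheory GRing.Theory Num.Theory.
Import numFieldNormedType.Exports.
Local Open Scope classical_set_scope.
Local Open Scope ring_scope.

(* The library's norm on matrices is the sup norm. *)
Definition enorm (R : realType) (d : nat) (x : 'cV[R]_d) : R :=
  Num.sqrt (\sum_i x i 0 ^+ 2).

(* A linear map of R^d is represented by its matrix, acting on column
   vectors on the left. *)
Record isometry_group (R : realType) (d : nat) := IsometryGroup {
  isometries :> {fset 'M[R]_d};
  isometry_group1 : 1%:M \in isometries;
  isometry_groupM : forall g h,
    g \in isometries -> h \in isometries -> g *m h \in isometries;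
  isometry_groupV : forall g, g \in isometries -> invmx g \in isometries;
  isometry_groupP : forall g, g \in isometries ->
    forall x : 'cV[R]_d, enorm (g *m x) = enorm x
}.

Section product_probability.
Context {disp : measure_display} {T : measurableType disp} {R : realType}.

Definition tuple_cons (n : nat) (x : T * n.-tuple T) : n.+1.-tuple T :=
  [tuple of x.1 :: x.2].

Lemma measurable_tuple_cons (n : nat) :
  measurable_fun [set: T * n.-tuple T] (@tuple_cons n).
Proof. exact: measurable_cons. Qed.

HB.instance Definition _ (n : nat) :=
  isMeasurableFun.Build _ _ _ _ (@tuple_cons n) (@measurable_tuple_cons n).

(* The law of a tuple of independent coordinates, the i-th one having law
   P i. *)
Fixpoint tuple_prob (n : nat) :
    ('I_n -> probability T R) -> probability (n.-tuple T) R :=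
  match n with
  | 0 => fun=> [the probability _ _ of \d_ ([tuple] : 0.-tuple T)]
  | n'.+1 => fun P => [the probability _ _ of
      distribution (P ord0 \x tuple_prob (fun i => P (lift ord0 i)))%E
                   (@tuple_cons n')]
  end.

End product_probability.

(* R^d as a measurable space is a tuple type over the Borel space
   measurableTypeR R, with the product sigma-algebra; R^d as a normed space is
   'cV[R]_d. *)
Definition vec (R : realType) (d : nat) (y : d.-tuple (measurableTypeR R)) :
    'cV[R]_d :=
  \col_i tnth y i.

(* N(m, I): independent coordinates, the i-th one being N(m_i, 1). *)
Definition gaussian (R : realType) (d : nat) (m : 'cV[R]_d) :
    probability (d.-tuple (measurableTypeR R)) R :=
  tuple_prob (fun i => [the probability _ _ of normal_prob (m i 0) 1]).

(* P_theta. The sum ranges over the elements of the group, so a center g theta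
   is counted once per g that produces it. *)
Definition mixture (R : realType) (d : nat) (G : isometry_group R d)
    (theta : 'cV[R]_d) (A : set (d.-tuple (measurableTypeR R))) : \bar R :=
  ((#|` G|%:R^-1)%:E * \sum_(g <- G) gaussian (g *m theta) A)%E.

Section mixture_probability.
Local Open Scope ereal_scope.
Context {R : realType} {d : nat} (G : isometry_group R d) (theta : 'cV[R]_d).

Let mixture0 : mixture G theta set0 = 0.
Proof. by rewrite /mixture big1 ?mule0// => g _; rewrite measure0. Qed.

Let mixture_ge0 A : 0 <= mixture G theta A.
Proof.
by rewrite mule_ge0 ?lee_fin ?invr_ge0 ?ler0n//; apply: sume_ge0.
Qed.

Let mixture_sigma_additive : semi_sigma_additive (mixture G theta).
Proof.
move=> F mF tF mUF; rewrite [X in X @ \oo --> _](_ : _ =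
    (fun n => (#|` G|%:R^-1)%:E *
       \sum_(g <- G) \sum_(0 <= i < n) gaussian (g *m theta) (F i))); last first.
  apply/funext => n; rewrite exchange_big/= ge0_sume_distrr// => i _.
  exact: sume_ge0.
apply: cvgeZl => //; apply: cvg_nnesum => [g _|g _].
  by apply: nearW => n; exact: sume_ge0.
exact: measure_semi_sigma_additive.
Qed.

HB.instance Definition _ := isMeasure.Build _ _ _ (mixture G theta)
  mixture0 mixture_ge0 mixture_sigma_additive.

Let mixture_setT : mixture G theta setT = 1.
Proof.
rewrite /mixture (eq_bigr (fun=> 1%:E)) => [|g _]; last first.
  exact: probability_setT.
rewrite sumEFin -EFinM big_const_seq count_predT iter_addr_0 mulVf//.
by rewrite pnatr_eq0 -lt0n cardfs_gt0; apply/fset0Pn; exists 1%:M;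
  exact: isometry_group1.
Qed.

HB.instance Definition _ :=
  Measure_isProbability.Build _ _ _ (mixture G theta) mixture_setT.

End mixture_probability.

(* The density of [mixture G theta] with respect to the Lebesgue measure. *)
Definition likelihood (R : realType) (d : nat) (G : isometry_group R d)
    (y theta : 'cV[R]_d) : R :=
  (#|` G|%:R * (2 * pi) `^ (d%:R / 2))^-1 *
  \sum_(g <- G) expR (- (2^-1 * enorm (y - g *m theta) ^+ 2)).

Definition Psi (R : realType) (d : nat) (G : isometry_group R d)
    (theta0 theta : 'cV[R]_d) : R :=
  fine 'E_(mixture G theta0)[fun y => ln (likelihood G (vec y) theta)].

(* 'D_v f x is an unspecified value where the derivative does not exist; it is
   applied below to Psi G theta0 only, which is smooth. *)
Definition hessian (R : realType) (d : nat) (f : 'cV[R]_d -> R)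
    (x : 'cV[R]_d) : 'M[R]_d :=
  \matrix_(i, j) 'D_(delta_mx i 0) ('D_(delta_mx j 0) f) x.

Definition fisher (R : realType) (d : nat) (G : isometry_group R d)
    (theta0 : 'cV[R]_d) : 'M[R]_d :=
  - hessian (Psi G theta0) theta0.

Definition posdefmx (R : realType) (d : nat) (A : 'M[R]_d) : Prop :=
  A^T = A /\ forall x : 'cV[R]_d, x != 0 -> 0 < (x^T *m A *m x) 0 0.

(* Main.v *)
(* The score [score y th v], the derivative of the log-likelihood in the
   direction [v], is the posterior mean of [<y, g v>] minus [<th, v>], and the
   Fisher information is the quadratic form [v |-> E (score Y th0 v)^2].
   If [g th0 = h th0] with [g <> h], then [k = g^-1 h] fixes [th0], and
   [v = w - k w] has zero score for every [w].  Conversely, if [E score^2 = 0],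
   testing the score against [exp <y, z>] and computing Gaussian moments gives
   [sum_g <z, g v> exp <z, g th0> = 0] for all [z].  When the centers are
   distinct, [<th0, g th0>] is maximal at [g = 1] only, so taking
   [z = t th0 + v] and [z = t th0 - v] with [t] going to infinity gives
   [t <th0, v> + |v|^2 -> 0] and [t <th0, v> - |v|^2 -> 0], hence [v = 0].
   All integrals are taken with respect to the standard Gaussian law, and every
   integrand is dominated by some integrable [C exp (a |y|_1)]. *)
Require Import Defs.
From mathcomp Require Import all_boot all_order all_algebra.
From mathcomp Require Import finmap.
From mathcomp Require Import all_classical all_reals all_analysis.
From mathcomp Require Import measurable_realfun.
From mathcomp Require Import ring lra.
Set Implicit Arguments.
Unset Strict Implicit.
Unset Printing Implicit Defensive.
Import Order.TTheory GRing.Theory Num.Theory.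
Import numFieldNormedType.Exports.
Local Open Scope classical_set_scope.
Local Open Scope ring_scope.

(** * Change of density in integrals of nonnegative functions *)

Section density.
Local Open Scope ereal_scope.
Context {disp} {T : measurableType disp} {R : realType}.
Context (nu mu : {measure set T -> \bar R}) (w : T -> R).
Hypothesis mw : measurable_fun setT w.
Hypothesis w0 : forall x, (0 <= w x)%R.
Hypothesis nuE : forall A, measurable A -> nu A = \int[mu]_(x in A) (w x)%:E.

Import HBNNSimple.

Let integral_density_nnsfun (h : {nnsfun T >-> R}) :
  \int[nu]_x (h x)%:E = \int[mu]_x ((h x)%:E * (w x)%:E).
Proof.
under [LHS]eq_integral do rewrite fimfunE -fsumEFin//.
rewrite [LHS]ge0_integral_fsum//; last 2 first.
  - by move=> r; exact/measurable_EFinP/measurableT_comp.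
  - by move=> n x _; rewrite EFinM nnfun_muleindic_ge0.
under [RHS]eq_integral.
  move=> x xD; rewrite fimfunE -fsumEFin// ge0_mule_fsuml; last first.
    by move=> r; rewrite EFinM nnfun_muleindic_ge0.
  over.
rewrite [RHS]ge0_integral_fsum//; last 2 first.
  - move=> r; apply: emeasurable_funM; last exact/measurable_EFinP.
    by apply/measurable_EFinP; apply: measurableT_comp.
  - move=> n x _; apply: mule_ge0; last by rewrite lee_fin.
    by rewrite EFinM nnfun_muleindic_ge0.
apply: eq_fsbigr => r _.
rewrite integralZl_indic_nnsfun//= integral_indic// setIT nuE//.
have mh : measurable (h @^-1` [set r]) by [].
under [RHS]eq_integral do rewrite EFinM -muleA.
(* A negative [r] is not a value of the nonnegative [h], so its fibre is empty and both sides
   vanish. *)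
have [r0|r0] := leP 0%R r.
  rewrite ge0_integralZl//=; first last.
  - by move=> x _; rewrite mule_ge0 ?lee_fin// indicE ler0n.
  - apply: emeasurable_funM; last exact/measurable_EFinP.
    by apply/measurable_EFinP.
  congr (_ * _); rewrite [LHS]integral_mkcond/=.
  apply: eq_integral => x _; rewrite patchE indicE.
  by case: ifPn => _; rewrite ?mul1e ?mul0e.
have -> : h @^-1` [set r] = set0.
  apply/seteqP; split => // x /= hx.
  by move: r0; rewrite -hx ltNge fun_ge0.
rewrite integral_set0 mule0 integral0_eq// => x _.
by rewrite indic0 mul0e mule0.
Qed.

(** The hypothesis [nuE] is the case of indicators; linearity gives simple functions, and monotone
    convergence along an increasing approximation of [f] gives the rest. *)
Lemma ge0_integral_density (f : T -> \bar R) :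
  measurable_fun setT f -> (forall x, 0 <= f x) ->
  \int[nu]_x f x = \int[mu]_x (f x * (w x)%:E).
Proof.
move=> mf f0; pose f_ := nnsfun_approx measurableT mf.
transitivity (limn (fun n => \int[nu]_x (f_ n x)%:E)).
  rewrite -monotone_convergence//=.
  - apply: eq_integral => x _; apply/esym/cvg_lim => //=.
    exact: cvg_nnsfun_approx.
  - by move=> n; apply: measurableT_comp.
  - by move=> n x _; rewrite lee_fin.
  - by move=> x _ a b ab; rewrite lee_fin//; exact/lefP/nd_nnsfun_approx.
transitivity (limn (fun n => \int[mu]_x ((f_ n x)%:E * (w x)%:E))).
  by congr (limn _); apply/funext => n; exact: integral_density_nnsfun.
rewrite -monotone_convergence//=.
- apply: eq_integral => x _; apply/cvg_lim => //=.
  apply: cvgeZr; first by [].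
  exact: cvg_nnsfun_approx.
- move=> n; apply: emeasurable_funM; last exact/measurable_EFinP.
  exact/measurable_EFinP.
- by move=> n x _; rewrite mule_ge0 ?lee_fin.
- move=> x _ a b ab; apply: lee_wpmul2r; first by rewrite lee_fin.
  by rewrite lee_fin//; exact/lefP/nd_nnsfun_approx.
Qed.

End density.

(** * Shifting the mean of a Gaussian law, in one and several dimensions *)

Section gaussian_density.
Context {R : realType}.

(** Both laws have Lebesgue densities, whose quotient is exp(x m - m^2/2). *)
Lemma ge0_integral_normal_prob (m : R) (f : R -> \bar R) :
  measurable_fun setT f -> (forall x, (0 <= f x)%E) ->
  (\int[normal_prob m 1]_x f x =
   \int[normal_prob 0 1]_x (f x * (expR (x * m - m ^+ 2 / 2))%:E))%E.
Proof.
move=> mf f0.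
have me : measurable_fun setT (fun x : R => expR (x * m - m ^+ 2 / 2)).
  apply: measurableT_comp => //; apply: measurable_funB => //.
  exact: measurable_funM.
rewrite (@ge0_integral_density _ _ _ _ lebesgue_measure (normal_pdf m 1))//;
  [|exact: measurable_normal_pdf|exact: normal_pdf_ge0].
rewrite (@ge0_integral_density _ _ _ (normal_prob 0 1) lebesgue_measure
    (normal_pdf 0 1))//;
  [|exact: measurable_normal_pdf|exact: normal_pdf_ge0|
   by apply: emeasurable_funM => //; exact/measurable_EFinP|
   by move=> x; rewrite mule_ge0 ?lee_fin ?expR_ge0].
apply: eq_integral => x _; rewrite -muleA -EFinM; congr (_ * _%:E)%E.
rewrite !normal_pdfE ?oner_eq0//= mulrCA -expRD; congr (_ * expR _).
by field.
Qed.

End gaussian_density.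

Lemma ge0_integral_tuple_prob_cons disp (T : measurableType disp)
    (R : realType) n (P : 'I_n.+1 -> probability T R)
    (f : n.+1.-tuple T -> \bar R) :
  measurable_fun setT f -> (forall x, (0 <= f x)%E) ->
  (\int[tuple_prob P]_y f y =
   \int[P ord0]_x \int[tuple_prob (fun i => P (lift ord0 i))]_t
     f (tuple_cons (x, t)))%E.
Proof.
move=> mf f0.
have mc : measurable_fun setT (f \o @tuple_cons _ T n).
  by apply: measurableT_comp => //; exact: measurable_tuple_cons.
rewrite /= ge0_integral_pushforward//= preimage_setT fubini_tonelli1//.
Qed.

Section gaussian_tuple.
Context {R : realType}.
Local Notation N m := [the probability _ _ of normal_prob (m : R) 1].

Lemma measurable_dot n (m : 'I_n -> R) :
  measurable_fun setT (fun y : n.-tuple (measurableTypeR R) =>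
    \sum_i tnth y i * m i).
Proof.
apply: measurable_sum => i; apply: measurable_funM => //.
exact: (measurable_tnth i).
Qed.

(** Induction on [n]. Tonelli splits off the first coordinate; the induction hypothesis shifts the
    remaining ones, the one-dimensional formula shifts the first, and the two exponential weights
    multiply to the weight in dimension n + 1. *)
Lemma ge0_integral_normal_tuple n (m : 'I_n -> R)
    (f : n.-tuple (measurableTypeR R) -> \bar R) :
  measurable_fun setT f -> (forall x, (0 <= f x)%E) ->
  (\int[tuple_prob (fun i => N (m i))]_y f y =
   \int[tuple_prob (fun i => N 0)]_y
     (f y * (expR (\sum_i tnth y i * m i - (\sum_i m i ^+ 2) / 2))%:E))%E.
Proof.
elim: n m f => [|n ih] m f mf f0.
  rewrite /=; apply: eq_integral => y _.
  by rewrite !big_ord0 mul0r subr0 expR0 mule1.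
pose e k (m : 'I_k -> R) (y : k.-tuple (measurableTypeR R)) :=
  expR (\sum_i tnth y i * m i - (\sum_i m i ^+ 2) / 2).
have me k m' : measurable_fun setT (e k m').
  rewrite /e; apply: measurableT_comp => //; apply: measurable_funB => //.
  exact: measurable_dot.
pose m' := m \o lift ord0.
pose g (p : measurableTypeR R * n.-tuple (measurableTypeR R)) :=
  (f (tuple_cons p) * (e n m' p.2)%:E)%E.
have mg : measurable_fun setT g.
  apply: emeasurable_funM.
    by apply: measurableT_comp => //; exact: measurable_tuple_cons.
  by apply/measurable_EFinP; exact: (measurableT_comp (me n m') measurable_snd).
have g0 p : (0 <= g p)%E by rewrite mule_ge0 ?lee_fin ?expR_ge0.
have mh : measurable_fun setT (fun y : n.+1.-tuple (measurableTypeR R) =>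
    f y * (e _ m y)%:E)%E.
  by apply: emeasurable_funM => //; apply/measurable_EFinP; exact: me.
have h0 (y : n.+1.-tuple (measurableTypeR R)) : (0 <= f y * (e _ m y)%:E)%E.
  by rewrite mule_ge0 ?lee_fin ?expR_ge0.
apply: etrans.
  exact: (@ge0_integral_tuple_prob_cons _ _ R n (fun i => N (m i)) f mf f0).
apply/esym; apply: etrans.
  exact: (@ge0_integral_tuple_prob_cons _ _ R n (fun=> N 0) _ mh h0).
apply/esym.
transitivity (\int[N (m ord0)]_x \int[tuple_prob (fun i => N 0)]_t g (x, t))%E.
  apply: eq_integral => x _; rewrite (ih m')//.
  exact: (measurableT_comp mf (measurableT_comp
    (@measurable_tuple_cons _ _ n) (measurable_pair1 x))).
apply: etrans.
  apply: (@ge0_integral_normal_prob _ (m ord0)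
    (fun x => \int[tuple_prob (fun=> N 0)]_t g (x, t))%E); last first.
    by move=> x; exact: integral_ge0.
  exact: (measurable_fun_fubini_tonelli_F (m2 := tuple_prob (fun=> N 0))).
apply: eq_integral => x _.
apply: etrans.
  apply/esym; apply: (@ge0_integralZr _ _ _ (tuple_prob (fun=> N 0)) _ _
    (fun t => g (x, t))) => //.
  - exact: (measurableT_comp mg (measurable_pair1 x)).
apply: eq_integral => t _.
rewrite /g/= -muleA -EFinM; congr (_ * _%:E)%E.
rewrite /e -expRD !big_ord_recl/= !(tnth_nth 0)/=; congr expR.
under [in RHS]eq_bigr do rewrite !(tnth_nth 0)/=.
under eq_bigr do rewrite !(tnth_nth 0)/=.
rewrite /m'/=; ring.
Qed.

End gaussian_tuple.

(** * The Euclidean inner product and linear isometries *)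

Definition dot {R : realType} {d : nat} (x u : 'cV[R]_d) : R :=
  \sum_i x i 0 * u i 0.

Section dot.
Context {R : realType} {d : nat}.
Implicit Types (x y u v : 'cV[R]_d) (a : R).

Lemma dotC x u : dot x u = dot u x.
Proof. by apply: eq_bigr => i _; rewrite mulrC. Qed.

Lemma dotDr x u v : dot x (u + v) = dot x u + dot x v.
Proof. by rewrite -big_split; apply: eq_bigr => i _; rewrite mxE mulrDr. Qed.

Lemma dotZr x a u : dot x (a *: u) = a * dot x u.
Proof. by rewrite mulr_sumr; apply: eq_bigr => i _; rewrite mxE mulrCA. Qed.

Lemma dotNr x u : dot x (- u) = - dot x u.
Proof. by rewrite -scaleN1r dotZr mulN1r. Qed.

Lemma dotDl x y u : dot (x + y) u = dot x u + dot y u.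
Proof. by rewrite dotC dotDr !(dotC u). Qed.

Lemma dotZl a x u : dot (a *: x) u = a * dot x u.
Proof. by rewrite dotC dotZr dotC. Qed.

Lemma dotNl x u : dot (- x) u = - dot x u.
Proof. by rewrite dotC dotNr dotC. Qed.

Lemma dot0r x : dot x 0 = 0.
Proof. by rewrite -(scale0r 0) dotZr mul0r. Qed.

Lemma dot_ge0 x : 0 <= dot x x.
Proof. by apply: sumr_ge0 => i _; rewrite -expr2 sqr_ge0. Qed.

Lemma dot_eq0 x : dot x x = 0 -> x = 0.
Proof.
move=> /psumr_eq0P h; apply/matrixP => i j; rewrite (ord1 j) mxE.
have /eqP : x i 0 * x i 0 = 0 by apply: h => // k _; rewrite -expr2 sqr_ge0.
by rewrite mulf_eq0 orbb => /eqP.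
Qed.

Lemma enorm_sqr x : enorm x ^+ 2 = dot x x.
Proof.
rewrite sqr_sqrtr; last by apply: sumr_ge0 => i _; rewrite sqr_ge0.
by apply: eq_bigr => i _; rewrite expr2.
Qed.

Section isometry.
Variables (G : isometry_group R d) (g : 'M[R]_d).
Hypothesis gG : g \in (G : {fset 'M[R]_d}).

(** Polarization: invariance of the norm at x, y and x + y gives invariance of the inner product. *)
Lemma dot_isometry x y : dot (g *m x) (g *m y) = dot x y.
Proof.
have E z : dot (g *m z) (g *m z) = dot z z.
  by rewrite -!enorm_sqr (isometry_groupP gG).
have := E (x + y); rewrite mulmxDr !dotDl !dotDr !E (dotC (g *m y)) (dotC y).
lra.
Qed.

(** The entries of g^T g are the inner products of the images of the basis vectors, hence those of
    the identity. *)
Lemma isometry_unitmx : g \in unitmx.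
Proof.
suff : g^T *m g = 1%:M by case/mulmx1_unit.
apply/matrixP => i j.
have := dot_isometry (delta_mx i 0) (delta_mx j 0).
rewrite -!colE => h; rewrite !mxE; transitivity (dot (col i g) (col j g)).
  by apply: eq_bigr => k _; rewrite !mxE.
rewrite h /dot (bigD1 i)//= big1 => [|k ki]; last by rewrite mxE (negbTE ki) mul0r.
by rewrite !mxE !eqxx addr0 mul1r andbT.
Qed.

End isometry.
End dot.

(** * Exponential integrals under the standard Gaussian law *)

Section gaussian_integral.
Context {R : realType} {d : nat}.
Local Notation Y := (d.-tuple (measurableTypeR R)).
Local Notation gamma := (gaussian (0 : 'cV[R]_d)).

Lemma dot_vec (y : Y) (u : 'cV[R]_d) : dot (vec y) u = \sum_i tnth y i * u i 0.
Proof. by apply: eq_bigr => i _; rewrite mxE. Qed.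

Lemma measurable_dot_vec (u : 'cV[R]_d) :
  measurable_fun setT (fun y : Y => dot (vec y) u).
Proof.
rewrite (_ : (fun y => _) = fun y : Y => \sum_i tnth y i * u i 0).
  exact: measurable_dot.
by apply/funext => y; exact: dot_vec.
Qed.

Lemma measurable_expR_dot (u : 'cV[R]_d) :
  measurable_fun setT (fun y : Y => expR (dot (vec y) u)).
Proof. by apply: measurableT_comp => //; exact: measurable_dot_vec. Qed.

Lemma ge0_integral_gaussian (m : 'cV[R]_d) (f : Y -> \bar R) :
  measurable_fun setT f -> (forall y, (0 <= f y)%E) ->
  (\int[gaussian m]_y f y =
   \int[gamma]_y (f y * (expR (dot (vec y) m - dot m m / 2))%:E))%E.
Proof.
move=> mf f0; apply: etrans.
  exact: (ge0_integral_normal_tuple (fun i => m i 0) mf f0).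
have -> : gamma =
    tuple_prob (fun=> [the probability _ _ of normal_prob (0 : R) 1]).
  by rewrite /gaussian; congr tuple_prob; apply/funext => i; rewrite mxE.
apply: eq_integral => y _; rewrite dot_vec; congr (_ * (expR (_ - _ / 2))%:E)%E.
Qed.

(** The moment generating function: N(u, I) has total mass 1, and written against [gamma] this mass
    is the integral of exp(<y, u> - |u|^2/2). *)
Lemma integral_expR_dot (u : 'cV[R]_d) :
  (\int[gamma]_y (expR (dot (vec y) u))%:E = (expR (dot u u / 2))%:E)%E.
Proof.
have := @ge0_integral_gaussian u (cst 1%E) (measurable_cst _) (fun=> lee01).
rewrite integral_cst//= probability_setT mule1 => /esym h.
have {h} : (\int[gamma]_y ((expR (- (dot u u / 2)))%:E *
    (expR (dot (vec y) u))%:E) = 1)%E.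
  by rewrite -[RHS]h; apply: eq_integral => y _; rewrite mul1e -EFinM -expRD addrC.
rewrite ge0_integralZl ?lee_fin ?expR_ge0//; last first.
  by apply/measurable_EFinP; exact: measurable_expR_dot.
move=> h; rewrite -[LHS]mul1e -[in LHS]expR0 -(subrr (dot u u / 2)) expRD EFinM.
by rewrite -muleA h mule1.
Qed.

Lemma integrable_expR_dot (u : 'cV[R]_d) :
  gamma.-integrable setT (EFin \o (fun y : Y => expR (dot (vec y) u))).
Proof.
apply/integrableP; split.
  by apply/measurable_EFinP; exact: measurable_expR_dot.
under eq_integral do rewrite /= ger0_norm ?expR_ge0//.
by rewrite integral_expR_dot ltry.
Qed.

Definition norm1 (y : Y) : R := \sum_i `|tnth y i|.

Lemma norm1_ge0 y : 0 <= norm1 y.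
Proof. exact: sumr_ge0. Qed.

Lemma measurable_norm1 : measurable_fun setT norm1.
Proof.
apply: measurable_sum => i; apply: measurableT_comp => //.
exact: (measurable_tnth i).
Qed.

(** Each factor exp(a |y_i|) is at most exp(a y_i) + exp(-a y_i). Expanding the product over
    coordinates gives a finite sum, over sign vectors [f], of the integrable functions exp <y, u
    f>. *)
Lemma integrable_expR_norm1 (a : R) :
  gamma.-integrable setT (EFin \o (fun y : Y => expR (a * norm1 y))).
Proof.
pose u (f : {ffun 'I_d -> bool}) : 'cV[R]_d := \col_i (a * (-1) ^+ f i).
apply: (@le_integrable _ _ _ gamma setT measurableT _
  (fun y => \sum_(f : {ffun 'I_d -> bool}) (expR (dot (vec y) (u f)))%:E)%E).
- apply/measurable_EFinP; apply: measurableT_comp => //.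
  by apply: measurable_funM => //; exact: measurable_norm1.
- move=> y _; rewrite sumEFin !abse_EFin lee_fin ger0_norm ?expR_ge0//.
  rewrite ger0_norm; last by apply: sumr_ge0 => f _; exact: expR_ge0.
  rewrite (_ : \sum_f _ = \prod_(i < d) \sum_(b : bool)
      expR (tnth y i * (a * (-1) ^+ b))); last first.
    rewrite bigA_distr_bigA; apply: eq_bigr => f _; rewrite dot_vec expR_sum.
    by apply: eq_bigr => i _; rewrite mxE.
  rewrite mulr_sumr expR_sum; apply: ler_prod => i _.
  rewrite expR_ge0/= big_bool/= expr1 expr0 mulrN1 mulr1 mulrN.
  rewrite (mulrC _ a).
  have [h|h] := leP 0 (tnth y i).
    by rewrite ger0_norm// lerDr expR_ge0.
  by rewrite ltr0_norm// mulrN lerDl expR_ge0.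
- by apply: integrable_sum => // f _; exact: integrable_expR_dot.
Qed.

End gaussian_integral.

(** * Differentiation under the integral sign *)

Section derive_under_integral.
Context {disp} {T : measurableType disp} {R : realType}.
Context (mu : {measure set T -> \bar R}).

Lemma is_derive_under_integral (F dF : R -> T -> R) (h : T -> R) :
  (forall t y, is_derive (t : R) (1 : R) (F ^~ y) (dF t y)) ->
  (forall t, `|t| < 1 -> mu.-integrable setT (EFin \o F t)) ->
  mu.-integrable setT (EFin \o h) ->
  (forall t y, `|t| < 1 -> `|dF t y| <= h y) ->
  is_derive (0 : R) (1 : R) (fun t => \int[mu]_y F t y) (\int[mu]_y dF 0 y).
Proof.
move=> dFE intF inth dFh.
have I0 : (`]-1, 1[%classic : set R) 0 by rewrite /= in_itv/= ltrN10 ltr01.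
have I1 t : (`]-1, 1[%classic : set R) t -> `|t| < 1.
  by rewrite /= in_itv/= ltr_norml.
have dE t y : partial1of2 F t y = dF t y.
  by rewrite partial1of2E; apply: derive_val.
have h0 y : 0 <= h y.
  by apply: le_trans (dFh 0 y _) => //; rewrite normr0.
have intF' t : (`]-1, 1[%classic : set R) t -> mu.-integrable setT (EFin \o F t).
  by move=> /I1; exact: intF.
have der t y : (`]-1, 1[%classic : set R) t -> setT y -> derivable (F ^~ y) t 1.
  by move=> _ _; exact: ex_derive.
have ub t y : (`]-1, 1[%classic : set R) t -> setT y ->
    `|partial1of2 F t y| <= h y.
  by move=> /I1 t1 _; rewrite dE; exact: dFh.
apply: DeriveDef.
  exact: (derivable_under_integral measurableT I0 intF' der h0 inth ub).
rewrite -derive1E.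
rewrite (differentiation_under_integral measurableT I0 intF' der h0 inth ub).
by apply: eq_Rintegral => y _; exact: dE.
Qed.

End derive_under_integral.

(** * Families of functions with uniform exponential growth *)

Section exp_bounded.
Context {R : realType} {d : nat}.
Local Notation Y := (d.-tuple (measurableTypeR R)).
Local Notation gamma := (gaussian (0 : 'cV[R]_d)).

(** The constants serve all |t| < 1 at once, which is the domination required to differentiate in
    [t] at 0. A single function is treated as a family constant in [t]. *)
Definition exp_bounded (F : R -> Y -> R) := exists C a : R,
  [/\ 0 <= C, 0 <= a &
    forall t y, `|t| < 1 -> `|F t y| <= C * expR (a * norm1 y)].

Implicit Types F G : R -> Y -> R.

Lemma exp_bounded_le F G :
  (forall t y, `|t| < 1 -> `|F t y| <= `|G t y|) ->
  exp_bounded G -> exp_bounded F.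
Proof.
move=> FG [C [a [C0 a0 h]]]; exists C, a; split => // t y t1.
exact: le_trans (FG _ _ t1) (h _ _ t1).
Qed.

Lemma exp_bounded_cst (c : R) : exp_bounded (fun _ _ => c).
Proof.
exists `|c|, 0; split => // t y _; rewrite mul0r expR0 mulr1//.
Qed.

Lemma exp_boundedD F G :
  exp_bounded F -> exp_bounded G -> exp_bounded (fun t y => F t y + G t y).
Proof.
move=> [C [a [C0 a0 hF]]] [D [b [D0 b0 hG]]]; exists (C + D), (a + b).
split; [exact: addr_ge0|exact: addr_ge0|move=> t y t1].
apply: le_trans (ler_normD _ _) _; rewrite mulrDl; apply: lerD.
- apply: le_trans (hF _ _ t1) _; rewrite ler_wpM2l// ler_expR.
  by rewrite ler_wpM2r ?norm1_ge0// lerDl.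
- apply: le_trans (hG _ _ t1) _; rewrite ler_wpM2l// ler_expR.
  by rewrite ler_wpM2r ?norm1_ge0// lerDr.
Qed.

Lemma exp_boundedM F G :
  exp_bounded F -> exp_bounded G -> exp_bounded (fun t y => F t y * G t y).
Proof.
move=> [C [a [C0 a0 hF]]] [D [b [D0 b0 hG]]]; exists (C * D), (a + b).
split; [exact: mulr_ge0|exact: addr_ge0|move=> t y t1].
by rewrite normrM mulrDl expRD mulrACA ler_pM// ?hF// hG.
Qed.

Lemma exp_boundedN F : exp_bounded F -> exp_bounded (fun t y => - F t y).
Proof. by apply: exp_bounded_le => t y _; rewrite normrN. Qed.

Lemma exp_boundedB F G :
  exp_bounded F -> exp_bounded G -> exp_bounded (fun t y => F t y - G t y).
Proof. by move=> bF /exp_boundedN; exact: exp_boundedD. Qed.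

Lemma exp_bounded_norm F :
  exp_bounded F -> exp_bounded (fun t y => `|F t y|).
Proof. by apply: exp_bounded_le => t y _; rewrite normr_id. Qed.

Lemma exp_bounded_sum (I : eqType) (s : seq I) (F : I -> R -> Y -> R) :
  {in s, forall i, exp_bounded (F i)} ->
  exp_bounded (fun t y => \sum_(i <- s) F i t y).
Proof.
elim: s => [|i s ih] bF.
  by apply: exp_bounded_le (exp_bounded_cst 0) => t y _; rewrite big_nil.
have bs : {in s, forall j, exp_bounded (F j)}.
  by move=> j js; apply: bF; rewrite inE js orbT.
apply: exp_bounded_le (exp_boundedD (bF i (mem_head _ _)) (ih bs)) => t y _.
by rewrite big_cons.
Qed.

Lemma exp_bounded_norm1 (a : R) : 0 <= a ->
  exp_bounded (fun _ y => expR (a * norm1 y)).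
Proof.
by move=> a0; exists 1, a; split => // t y _; rewrite mul1r ger0_norm ?expR_ge0.
Qed.

Lemma dot_le_norm1 (y : Y) (u v : 'cV[R]_d) (t : R) : `|t| < 1 ->
  `|dot (vec y) (u + t *: v)| <=
  (\sum_i `|u i 0| + \sum_i `|v i 0|) * norm1 y.
Proof.
move=> t1; rewrite dot_vec /norm1 mulr_sumr.
apply: le_trans (ler_norm_sum _ _ _) _; apply: ler_sum => i _.
rewrite normrM mulrC ler_wpM2r// !mxE.
apply: le_trans (ler_normD _ _) _; apply: lerD.
  by rewrite (bigD1 i)//= lerDl sumr_ge0.
rewrite normrM (bigD1 i)//=; apply: (@le_trans _ _ `|v i 0|).
  by rewrite ler_piMl// ltW.
by rewrite lerDl sumr_ge0.
Qed.

Lemma exp_bounded_dot_line (u v : 'cV[R]_d) :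
  exp_bounded (fun t y => dot (vec y) (u + t *: v)).
Proof.
set a := \sum_i `|u i 0| + \sum_i `|v i 0|.
have a0 : 0 <= a by rewrite addr_ge0 ?sumr_ge0.
apply: exp_bounded_le (exp_bounded_norm1 a0) => t y t1.
apply: le_trans (dot_le_norm1 y u v t1) _; rewrite ger0_norm ?expR_ge0//.
(* Linear growth is absorbed by x <= 1 + x <= exp x. *)
by apply: le_trans (expR_ge1Dx _); rewrite lerDr.
Qed.

Lemma exp_bounded_expR_dot_line (u v : 'cV[R]_d) :
  exp_bounded (fun t y => expR (dot (vec y) (u + t *: v))).
Proof.
set a := \sum_i `|u i 0| + \sum_i `|v i 0|.
have a0 : 0 <= a by rewrite addr_ge0 ?sumr_ge0.
apply: exp_bounded_le (exp_bounded_norm1 a0) => t y t1.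
rewrite !ger0_norm ?expR_ge0// ler_expR.
exact: le_trans (ler_norm _) (dot_le_norm1 y u v t1).
Qed.

Lemma exp_bounded_dot (u : 'cV[R]_d) : exp_bounded (fun _ y => dot (vec y) u).
Proof.
apply: exp_bounded_le (exp_bounded_dot_line u 0) => t y _.
by rewrite scaler0 addr0.
Qed.

Lemma exp_bounded_expR_dot (u : 'cV[R]_d) :
  exp_bounded (fun _ y => expR (dot (vec y) u)).
Proof.
apply: exp_bounded_le (exp_bounded_expR_dot_line u 0) => t y _.
by rewrite scaler0 addr0.
Qed.

Lemma exp_bounded_integrable (f : Y -> R) :
  measurable_fun setT f -> exp_bounded (fun=> f) ->
  gamma.-integrable setT (EFin \o f).
Proof.
move=> mf [C [a [C0 a0 h]]].
apply: (@le_integrable _ _ _ gamma setT measurableT _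
  (EFin \o (fun y => C * expR (a * norm1 y)))).
- exact/measurable_EFinP.
- move=> y _; rewrite lee_fin; apply: le_trans (h 0 y _) (ler_norm _).
  by rewrite normr0.
- rewrite (_ : EFin \o _ = (fun y => C%:E * (expR (a * norm1 y))%:E)%E)//.
  by apply: integrableZl => //; exact: integrable_expR_norm1.
Qed.

(** The exponential bound on [dF] is the integrable dominating function, and the one on [F] makes
    each slice integrable. *)
Lemma is_derive_gaussian_integral (F dF : R -> Y -> R) :
  (forall t, measurable_fun setT (F t)) ->
  (forall t y, is_derive (t : R) (1 : R) (F ^~ y) (dF t y)) ->
  exp_bounded F -> exp_bounded dF ->
  is_derive (0 : R) (1 : R) (fun t => \int[gamma]_y F t y) (\int[gamma]_y dF 0 y).
Proof.
move=> mF dFE bF [C [a [C0 a0 h]]].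
apply: (@is_derive_under_integral _ _ _ gamma F dF
  (fun y => C * expR (a * norm1 y))) => //.
- move=> t t1; apply: exp_bounded_integrable => //.
  case: bF => [C' [a' [? ? h']]]; exists C', a'; split => // _ y _.
  exact: h'.
- rewrite (_ : EFin \o _ = (fun y => C%:E * (expR (a * norm1 y))%:E)%E)//.
  by apply: integrableZl => //; exact: integrable_expR_norm1.
Qed.

End exp_bounded.

(** * First and second exponentially tilted Gaussian moments *)

Section moments.
Context {R : realType} {d : nat}.
Local Notation Y := (d.-tuple (measurableTypeR R)).
Local Notation gamma := (gaussian (0 : 'cV[R]_d)).
Implicit Types u v w x : 'cV[R]_d.

Lemma is_derive_dot_line x u v (t : R) :
  is_derive (t : R) (1 : R) (fun s : R => dot x (u + s *: v)) (dot x v).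
Proof.
rewrite (_ : (fun s => _) = (fun s : R => dot x u + s * dot x v)); last first.
  by apply/funext => s; rewrite dotDr dotZr.
apply: is_derive_eq; rewrite /GRing.scale/=; ring.
Qed.

Lemma is_derive_expR_comp (f : R -> R) (t df : R) :
  is_derive (t : R) (1 : R) f df ->
  is_derive (t : R) (1 : R) (fun s => expR (f s)) (df * expR (f t)).
Proof.
move=> fE; have := @is_derive1_comp R expR f t _ _ (is_derive_expR (f t)) fE.
by rewrite mulrC.
Qed.

Lemma is_derive_sqr_dot_line u v :
  is_derive (0 : R) (1 : R)
    (fun t : R => dot (u + t *: v) (u + t *: v) / 2) (dot u v).
Proof.
rewrite (_ : (fun s => _) = (fun s : R => dot u u / 2 + s * dot u v +
    s * s * (dot v v / 2))); last first.
  apply/funext => s; rewrite !(dotDl, dotDr) !(dotZl, dotZr) (dotC v u).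
  by field.
apply: is_derive_eq; rewrite /GRing.scale/=; ring.
Qed.

Lemma Rintegral_expR_dot u :
  \int[gamma]_y expR (dot (vec y) u) = expR (dot u u / 2).
Proof. by rewrite /Rintegral integral_expR_dot. Qed.

(** The moment generating function at u + t v is differentiated at t = 0 twice over, under the
    integral ([D1]) and in closed form ([D2]); the two derivatives agree. *)
Lemma Rintegral_dot_expR_dot u v :
  \int[gamma]_y (dot (vec y) v * expR (dot (vec y) u)) =
  dot u v * expR (dot u u / 2).
Proof.
have D1 : is_derive (0 : R) (1 : R)
    (fun t : R => \int[gamma]_y expR (dot (vec y) (u + t *: v)))
    (\int[gamma]_y (dot (vec y) v * expR (dot (vec y) (u + 0 *: v)))).
  apply: (@is_derive_gaussian_integral _ _
    (fun t y => expR (dot (vec y) (u + t *: v)))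
    (fun t y => dot (vec y) v * expR (dot (vec y) (u + t *: v)))).
  - by move=> t; exact: measurable_expR_dot.
  - by move=> t y; apply: is_derive_expR_comp; exact: is_derive_dot_line.
  - exact: exp_bounded_expR_dot_line.
  - apply: exp_boundedM; first exact: exp_bounded_dot.
    exact: exp_bounded_expR_dot_line.
have D2 : is_derive (0 : R) (1 : R)
    (fun t : R => \int[gamma]_y expR (dot (vec y) (u + t *: v)))
    (dot u v * expR (dot u u / 2)).
  under eq_fun do rewrite Rintegral_expR_dot.
  have := is_derive_expR_comp (is_derive_sqr_dot_line u v).
  by rewrite scale0r addr0.
have := @derive_val _ _ _ _ _ _ _ D2; rewrite (@derive_val _ _ _ _ _ _ _ D1).
by rewrite scale0r addr0.
Qed.

(** The same comparison, starting from the first moment and moving [u] in the direction [w]. *)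
Lemma Rintegral_dot2_expR_dot u v w :
  \int[gamma]_y (dot (vec y) v * dot (vec y) w * expR (dot (vec y) u)) =
  (dot v w + dot u v * dot u w) * expR (dot u u / 2).
Proof.
have D1 : is_derive (0 : R) (1 : R)
    (fun t : R => \int[gamma]_y (dot (vec y) v * expR (dot (vec y) (u + t *: w))))
    (\int[gamma]_y (dot (vec y) v * (dot (vec y) w *
       expR (dot (vec y) (u + 0 *: w))))).
  apply: (@is_derive_gaussian_integral _ _
    (fun t y => dot (vec y) v * expR (dot (vec y) (u + t *: w)))
    (fun t y => dot (vec y) v *
       (dot (vec y) w * expR (dot (vec y) (u + t *: w))))).
  - move=> t; apply: measurable_funM; first exact: measurable_dot_vec.
    exact: measurable_expR_dot.
  - move=> t y.
    have dE := is_derive_expR_comp (is_derive_dot_line (vec y) u w t).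
    by apply: is_derive_eq; rewrite /GRing.scale/= ?mulr0 ?addr0 ?add0r.
  - apply: exp_boundedM; first exact: exp_bounded_dot.
    exact: exp_bounded_expR_dot_line.
  - apply: exp_boundedM; first exact: exp_bounded_dot.
    apply: exp_boundedM; first exact: exp_bounded_dot.
    exact: exp_bounded_expR_dot_line.
have D2 : is_derive (0 : R) (1 : R)
    (fun t : R => \int[gamma]_y (dot (vec y) v * expR (dot (vec y) (u + t *: w))))
    ((dot v w + dot u v * dot u w) * expR (dot u u / 2)).
  under eq_fun do rewrite Rintegral_dot_expR_dot.
  have E := is_derive_expR_comp (is_derive_sqr_dot_line u w).
  have D := is_derive_dot_line v u w 0.
  under eq_fun do rewrite (dotC _ v).
  apply: is_derive_eq; rewrite scale0r addr0 /GRing.scale/= (dotC v u); ring.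
have := @derive_val _ _ _ _ _ _ _ D2; rewrite (@derive_val _ _ _ _ _ _ _ D1).
rewrite scale0r addr0 => <-.
by apply: eq_Rintegral => y _; rewrite mulrA.
Qed.

End moments.

(** * An algebra of integrable functions *)

Section tame.
Context {R : realType} {d : nat}.
Local Notation Y := (d.-tuple (measurableTypeR R)).
Local Notation gamma := (gaussian (0 : 'cV[R]_d)).
Implicit Types f g : Y -> R.

(** Unlike integrability, this property is stable under products; it supplies the side conditions of
    every later use of linearity of the integral. *)
Definition tame f := measurable_fun setT f /\ exp_bounded (fun=> f).

Lemma tame_cst c : tame (fun=> c).
Proof. by split; [exact: measurable_cst|exact: exp_bounded_cst]. Qed.

Lemma tameD f g : tame f -> tame g -> tame (fun y => f y + g y).
Proof.
by move=> [mf bf] [mg bg]; split; [exact: measurable_funD|exact: exp_boundedD].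
Qed.

Lemma tameM f g : tame f -> tame g -> tame (fun y => f y * g y).
Proof.
by move=> [mf bf] [mg bg]; split; [exact: measurable_funM|exact: exp_boundedM].
Qed.

Lemma tameB f g : tame f -> tame g -> tame (fun y => f y - g y).
Proof.
by move=> [mf bf] [mg bg]; split; [exact: measurable_funB|exact: exp_boundedB].
Qed.

Lemma tame_sum (I : eqType) (s : seq I) (F : I -> Y -> R) :
  {in s, forall i, tame (F i)} -> tame (fun y => \sum_(i <- s) F i y).
Proof.
move=> tF; split; last by apply: exp_bounded_sum => i /tF[].
elim: s tF => [|i s ih] tF.
  rewrite (_ : (fun y => _) = cst 0); first exact: measurable_cst.
  by apply/funext => y; rewrite big_nil.
rewrite (_ : (fun y => _) = (fun y => F i y + \sum_(j <- s) F j y)); last first.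
  by apply/funext => y; rewrite big_cons.
apply: measurable_funD; first by have [] := tF i (mem_head _ _).
by apply: ih => j js; apply: tF; rewrite inE js orbT.
Qed.

Lemma tame_dot u : tame (fun y => dot (vec y) u).
Proof. by split; [exact: measurable_dot_vec|exact: exp_bounded_dot]. Qed.

Lemma tame_expR_dot u : tame (fun y => expR (dot (vec y) u)).
Proof. by split; [exact: measurable_expR_dot|exact: exp_bounded_expR_dot]. Qed.

Lemma tame_integrable f : tame f -> gamma.-integrable setT (EFin \o f).
Proof. by move=> [mf bf]; exact: exp_bounded_integrable. Qed.

Lemma Rintegral_tameD f g : tame f -> tame g ->
  \int[gamma]_y (f y + g y) = \int[gamma]_y f y + \int[gamma]_y g y.
Proof. by move=> /tame_integrable ? /tame_integrable ?; exact: RintegralD. Qed.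

Lemma Rintegral_tameZ (c : R) f : tame f ->
  \int[gamma]_y (c * f y) = c * \int[gamma]_y f y.
Proof. by move=> /tame_integrable ?; exact: RintegralZl. Qed.

Lemma Rintegral_tame_sum (I : eqType) (s : seq I) (F : I -> Y -> R) :
  {in s, forall i, tame (F i)} ->
  \int[gamma]_y (\sum_(i <- s) F i y) = \sum_(i <- s) \int[gamma]_y F i y.
Proof.
elim: s => [|i s ih] tF.
  rewrite big_nil (@eq_Rintegral _ _ _ _ _ (cst 0)).
    by rewrite Rintegral_cst// mul0r.
  by move=> y _; rewrite big_nil.
have ts : {in s, forall j, tame (F j)}.
  by move=> j js; apply: tF; rewrite inE js orbT.
rewrite big_cons -ih// -Rintegral_tameD//; last exact: tame_sum.
  by apply: eq_Rintegral => y _; rewrite big_cons.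
exact: tF (mem_head _ _).
Qed.

End tame.

(** * Integrals against the mixture *)

Section mixture_integral.
Context {R : realType} {d : nat} (G : isometry_group R d).
Local Notation Y := (d.-tuple (measurableTypeR R)).
Local Notation gamma := (gaussian (0 : 'cV[R]_d)).
Implicit Types (y : Y) (th u v : 'cV[R]_d) (g : 'M[R]_d).

Lemma card_isometries_gt0 : 0 < #|` G|%:R :> R.
Proof.
by rewrite ltr0n cardfs_gt0; apply/fset0Pn; exists 1%:M; exact: isometry_group1.
Qed.

(* Density of [mixture G th] with respect to the standard Gaussian law. *)
Definition mixture_density th (y : Y) : R :=
  #|` G|%:R^-1 * \sum_(g <- G) expR (dot (vec y) (g *m th) - dot th th / 2).

Lemma mixture_density_ge0 th y : 0 <= mixture_density th y.
Proof.
by rewrite mulr_ge0// ?invr_ge0// sumr_ge0// => g _; exact: expR_ge0.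
Qed.

Lemma tame_expR_dotB u (c : R) : tame (fun y : Y => expR (dot (vec y) u - c)).
Proof.
rewrite (_ : (fun y => _) = (fun y : Y => expR (dot (vec y) u) * expR (- c))).
  by apply: tameM; [exact: tame_expR_dot|exact: tame_cst].
by apply/funext => y; rewrite expRD.
Qed.

Lemma tame_mixture_density th : tame (mixture_density th).
Proof.
apply: tameM; first exact: tame_cst.
by apply: tame_sum => g _; exact: tame_expR_dotB.
Qed.

(** Each component is shifted to mean 0. Since |g th| = |th|, all components carry the same constant
    exp(-|th|^2/2). *)
Lemma mixtureE th (A : set Y) : measurable A ->
  mixture G th A = (\int[gamma]_(y in A) (mixture_density th y)%:E)%E.
Proof.
move=> mA; rewrite /mixture /mixture_density.
have me g : measurable_fun A
    (fun y : Y => (expR (dot (vec y) (g *m th) - dot th th / 2))%:E).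
  apply/measurable_EFinP/measurable_funTS.
  by have [] := tame_expR_dotB (g *m th) (dot th th / 2).
under [RHS]eq_integral do rewrite EFinM -sumEFin.
rewrite ge0_integralZl//; first last.
- by move=> y _; apply: sume_ge0 => g _; rewrite lee_fin expR_ge0.
- exact: emeasurable_sum.
rewrite ge0_integral_sum//.
congr (_ * _)%E; rewrite !big_seq; apply: eq_bigr => g gG.
transitivity (\int[gaussian (g *m th)]_y (\1_A y)%:E)%E.
  by rewrite integral_indic// setIT.
rewrite ge0_integral_gaussian//; last exact/measurable_EFinP/measurable_indic.
rewrite [RHS]integral_mkcond/=.
apply: eq_integral => y _; rewrite patchE indicE (dot_isometry gG).
by case: ifPn => _; rewrite ?mul1e ?mul0e.
Qed.

(** The change of density is applied separately to the positive and negative parts of [f];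
    multiplying by a nonnegative density commutes with taking these parts. *)
Lemma Rintegral_mixture th (f : Y -> R) : measurable_fun setT f ->
  \int[mixture G th]_y f y = \int[gamma]_y (f y * mixture_density th y).
Proof.
move=> mf; have [mW _] := tame_mixture_density th.
rewrite /Rintegral; congr fine.
have W0 := mixture_density_ge0 th.
rewrite integralE [RHS]integralE.
have mE : measurable_fun setT (EFin \o f) by exact/measurable_EFinP.
have maxM (a b : R) : 0 <= b -> (maxe a%:E 0 * b%:E = maxe (a * b)%:E 0)%E.
  by move=> b0; rewrite -!EFin_max -EFinM maxr_pMl// mul0r.
congr (_ - _)%E; apply: etrans.
- apply: (ge0_integral_density mW W0 (mixtureE th)) => //.
  exact: (measurable_funepos mE).
- by apply: eq_integral => y _; rewrite !funeposE maxM.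
- apply: (ge0_integral_density mW W0 (mixtureE th)) => //.
  exact: (measurable_funeneg mE).
- by apply: eq_integral => y _; rewrite !funenegE -!EFinN maxM// mulNr.
Qed.

End mixture_integral.

(** * Posterior weights, the score and its derivative *)

Section score.
Context {R : realType} {d : nat} (G : isometry_group R d).
Local Notation Y := (d.-tuple (measurableTypeR R)).
Local Notation gamma := (gaussian (0 : 'cV[R]_d)).
Implicit Types (y : Y) (th u v : 'cV[R]_d) (g : 'M[R]_d).

(** Up to a constant and the factors exp(-|y|^2/2) and exp(-|th|^2/2), this is the likelihood. *)
Definition partition_fun y th : R := \sum_(g <- G) expR (dot (vec y) (g *m th)).

Lemma expR_le_partition_fun y th g : g \in (G : {fset 'M[R]_d}) ->
  expR (dot (vec y) (g *m th)) <= partition_fun y th.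
Proof.
move=> gG; rewrite /partition_fun (big_rem g)//= lerDl.
by apply: sumr_ge0 => h _; exact: expR_ge0.
Qed.

Lemma partition_fun_gt0 y th : 0 < partition_fun y th.
Proof.
exact: lt_le_trans (expR_gt0 _)
  (expR_le_partition_fun y th (isometry_group1 G)).
Qed.

(** The conditional probability of the component [g] given the observation [y]. Writing the quotient
    as one exponential lets its derivative follow from that of the log-partition function. *)
Definition posterior y th g : R :=
  expR (dot (vec y) (g *m th) - ln (partition_fun y th)).

Lemma posteriorE y th g :
  posterior y th g = expR (dot (vec y) (g *m th)) / partition_fun y th.
Proof.
by rewrite /posterior expRD expRN lnK// posrE partition_fun_gt0.
Qed.

Lemma posterior_norm_le1 y th g : g \in (G : {fset 'M[R]_d}) ->
  `|posterior y th g| <= 1.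
Proof.
move=> gG; rewrite ger0_norm ?expR_ge0// posteriorE.
by rewrite ler_pdivrMr ?partition_fun_gt0// mul1r expR_le_partition_fun.
Qed.

Definition posterior_mean y th v : R :=
  \sum_(g <- G) posterior y th g * dot (vec y) (g *m v).

Definition score y th v : R := posterior_mean y th v - dot th v.

Lemma posterior_meanE y th v : posterior_mean y th v =
  (\sum_(g <- G) dot (vec y) (g *m v) * expR (dot (vec y) (g *m th))) /
  partition_fun y th.
Proof.
rewrite mulr_suml; apply: eq_bigr => g _.
by rewrite posteriorE mulrC mulrA.
Qed.

Lemma is_derive_sum_seq (I : Type) (s : seq I) (F : I -> R -> R) (dF : I -> R)
    (t : R) :
  (forall i, is_derive (t : R) (1 : R) (F i) (dF i)) ->
  is_derive (t : R) (1 : R) (fun x => \sum_(i <- s) F i x) (\sum_(i <- s) dF i).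
Proof.
move=> FE; elim: s => [|i s ih].
  rewrite big_nil (_ : (fun x => _) = cst 0); first exact: is_derive_cst.
  by apply/funext => x; rewrite big_nil.
rewrite big_cons (_ : (fun x => _) = (fun x => F i x + \sum_(j <- s) F j x)).
  exact: is_deriveD.
by apply/funext => x; rewrite big_cons.
Qed.

Lemma is_derive_dot_mul_line y g th v (t : R) : is_derive (t : R) (1 : R)
  (fun s : R => dot (vec y) (g *m (th + s *: v))) (dot (vec y) (g *m v)).
Proof.
rewrite (_ : (fun s => _) = (fun s : R => dot (vec y) (g *m th + s *: (g *m v)))).
  exact: is_derive_dot_line.
by apply/funext => s; rewrite mulmxDr scalemxAr.
Qed.

Lemma is_derive_ln_partition_fun y th v (t : R) :
  is_derive (t : R) (1 : R) (fun s : R => ln (partition_fun y (th + s *: v)))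
    (posterior_mean y (th + t *: v) v).
Proof.
have ZE : is_derive (t : R) (1 : R) (fun s : R => partition_fun y (th + s *: v))
    (\sum_(g <- G) dot (vec y) (g *m v) *
      expR (dot (vec y) (g *m (th + t *: v)))).
  apply: is_derive_sum_seq => g; apply: is_derive_expR_comp.
  exact: is_derive_dot_mul_line.
have := is_derive1_comp (is_derive1_ln (partition_fun_gt0 y (th + t *: v))) ZE.
by rewrite posterior_meanE mulrC.
Qed.

(** The sum is the posterior covariance of <y, g u> and <y, g v>: differentiating a posterior weight
    multiplies it by the centered <y, g u>. *)
Lemma is_derive_score y th u v (t : R) :
  is_derive (t : R) (1 : R) (fun s : R => score y (th + s *: u) v)
    (\sum_(g <- G) posterior y (th + t *: u) g *
        (dot (vec y) (g *m u) - posterior_mean y (th + t *: u) u) *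
        dot (vec y) (g *m v) - dot u v).
Proof.
rewrite (_ : (fun s : R => score y (th + s *: u) v) =
  (fun s : R => \sum_(g <- G) (posterior y (th + s *: u) g * dot (vec y) (g *m v))
    - dot v (th + s *: u))); last first.
  by apply/funext => s; rewrite /score (dotC v).
rewrite (dotC u v); apply: is_deriveB; last exact: is_derive_dot_line.
apply: is_derive_sum_seq => g.
have pE : is_derive (t : R) (1 : R) (fun s : R => posterior y (th + s *: u) g)
    ((dot (vec y) (g *m u) - posterior_mean y (th + t *: u) u) *
     posterior y (th + t *: u) g).
  apply: is_derive_expR_comp; apply: is_deriveB.
    exact: is_derive_dot_mul_line.
  exact: is_derive_ln_partition_fun.
by apply: is_derive_eq; rewrite /GRing.scale/=; ring.
Qed.

(** Expanding |y - g th|^2 and using |g th| = |th| leaves <y, g th> as the only term that depends on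
    [g]. *)
Lemma ln_likelihoodE (y : 'cV[R]_d) th :
  ln (likelihood G y th) =
  ln (#|` G|%:R * (2 * pi) `^ (d%:R / 2))^-1 - dot y y / 2 +
  (ln (\sum_(g <- G) expR (dot y (g *m th))) - dot th th / 2).
Proof.
rewrite /likelihood.
have -> : \sum_(g <- G) expR (- (2^-1 * enorm (y - g *m th) ^+ 2)) =
    expR (- (dot y y / 2) - dot th th / 2) *
    \sum_(g <- G) expR (dot y (g *m th)).
  rewrite mulr_sumr !big_seq; apply: eq_bigr => g gG; rewrite -expRD.
  rewrite enorm_sqr !(dotDl, dotDr, dotNl, dotNr) (dot_isometry gG).
  by rewrite (dotC _ y); congr expR; field.
have Z0 : 0 < \sum_(g <- G) expR (dot y (g *m th)).
  rewrite (big_rem 1%:M) ?isometry_group1//= ltr_wpDr ?expR_gt0//.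
  by apply: sumr_ge0 => h _; exact: expR_ge0.
have c0 : 0 < (#|` G|%:R * (2 * pi) `^ (d%:R / 2))^-1 :> R.
  rewrite invr_gt0 mulr_gt0 ?card_isometries_gt0// powR_gt0// mulr_gt0//.
  exact: pi_gt0.
rewrite !lnM ?posrE ?mulr_gt0 ?expR_gt0// expRK; ring.
Qed.

End score.

(** Reduces directional derivatives to derivatives at 0 of functions of one real variable, the form
    in which the integrals are differentiated. *)
Lemma derive_line (R : realType) (d : nat) (f : 'cV[R]_d -> R) (a v : 'cV[R]_d)
    (df : R) :
  is_derive (0 : R) (1 : R) (fun t : R => f (a + t *: v)) df ->
  'D_v f a = df.
Proof.
move=> fE; rewrite -(@derive_val _ _ _ _ _ _ _ fE) /derive.
rewrite (_ : (fun h => h^-1 *: ((f \o shift a) (h *: v) - f a)) =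
  (fun h : R => h^-1 *: (((fun t : R => f (a + t *: v)) \o shift 0) (h *: (1 : R)) -
     f (a + 0 *: v))))//.
apply/funext => h /=.
by rewrite scale0r !addr0 (addrC (h *: v)) /GRing.scale/= mulr1.
Qed.

(** * Measurability and growth of the log-likelihood and the score *)

Section fisher.
Context {R : realType} {d : nat} (G : isometry_group R d).
Local Notation Y := (d.-tuple (measurableTypeR R)).
Local Notation gamma := (gaussian (0 : 'cV[R]_d)).
Implicit Types (y : Y) (th u v : 'cV[R]_d) (g : 'M[R]_d).

Lemma measurable_ln_partition_fun th :
  measurable_fun setT (fun y => ln (partition_fun G y th)).
Proof.
apply: measurableT_comp; first exact: measurable_ln.
by apply: measurable_sum => g; exact: measurable_expR_dot.
Qed.

Lemma measurable_posterior th g :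
  measurable_fun setT (fun y => posterior G y th g).
Proof.
apply: measurableT_comp => //; apply: measurable_funB.
  exact: measurable_dot_vec.
exact: measurable_ln_partition_fun.
Qed.

Lemma measurable_posterior_mean th v :
  measurable_fun setT (fun y => posterior_mean G y th v).
Proof.
apply: measurable_sum => g; apply: measurable_funM.
  exact: measurable_posterior.
exact: measurable_dot_vec.
Qed.

Lemma measurable_score th v : measurable_fun setT (fun y => score G y th v).
Proof. by apply: measurable_funB => //; exact: measurable_posterior_mean. Qed.

Lemma measurable_ln_likelihood th :
  measurable_fun setT (fun y => ln (likelihood G (vec y) th)).
Proof.
under eq_fun do rewrite ln_likelihoodE.
apply: measurable_funD.
  apply: measurable_funB => //; apply: measurable_funM => //.
  apply: measurable_sum => i; under eq_fun do rewrite !mxE.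
  by apply: measurable_funM; exact: (measurable_tnth i).
by apply: measurable_funB => //; exact: measurable_ln_partition_fun.
Qed.

Lemma exp_bounded_posterior th v g : g \in (G : {fset 'M[R]_d}) ->
  exp_bounded (fun t y => posterior G y (th + t *: v) g).
Proof.
move=> gG; apply: exp_bounded_le (exp_bounded_cst 1) => t y _.
by rewrite normr1 posterior_norm_le1.
Qed.

Lemma exp_bounded_posterior_mean th u v :
  exp_bounded (fun t y => posterior_mean G y (th + t *: u) v).
Proof.
apply: exp_bounded_sum => g gG; apply: exp_boundedM.
  exact: exp_bounded_posterior.
exact: exp_bounded_dot.
Qed.

Lemma exp_bounded_id : exp_bounded (fun (t : R) y => t).
Proof.
apply: exp_bounded_le (exp_bounded_cst 1) => t y t1.
by rewrite normr1 ltW.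
Qed.

Lemma exp_bounded_dot_param th u v :
  exp_bounded (fun t y => dot (th + t *: u) v).
Proof.
apply: (@exp_bounded_le _ _ _ (fun (t : R) y => dot th v + t * dot u v)).
  by move=> t y _; rewrite dotDl dotZl.
apply: exp_boundedD; first exact: exp_bounded_cst.
by apply: exp_boundedM; [exact: exp_bounded_id|exact: exp_bounded_cst].
Qed.

Lemma exp_bounded_score th u v :
  exp_bounded (fun t y => score G y (th + t *: u) v).
Proof.
apply: exp_boundedB; first exact: exp_bounded_posterior_mean.
exact: exp_bounded_dot_param.
Qed.

(** With Z the partition function, ln Z <= Z from above, and ln Z >= <y, th + t v> from below, by
    keeping only the term g = 1. *)
Lemma exp_bounded_ln_partition_fun th v :
  exp_bounded (fun t y => ln (partition_fun G y (th + t *: v))).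
Proof.
apply: (@exp_bounded_le _ _ _
  (fun t y => `|dot (vec y) (th + t *: v)| +
     \sum_(g <- G) expR (dot (vec y) (g *m th + t *: (g *m v))))); last first.
  apply: exp_boundedD.
    exact/exp_bounded_norm/exp_bounded_dot_line.
  by apply: exp_bounded_sum => g _; exact: exp_bounded_expR_dot_line.
move=> t y _; set th' := th + t *: v.
have -> : \sum_(g <- G) expR (dot (vec y) (g *m th + t *: (g *m v))) =
    partition_fun G y th'.
  by apply: eq_bigr => g _; rewrite mulmxDr scalemxAr.
have Z0 := partition_fun_gt0 G y th'.
rewrite [leRHS]ger0_norm ?addr_ge0 ?normr_ge0 ?(ltW Z0)// ler_norml.
apply/andP; split.
  apply: (@le_trans _ _ (- `|dot (vec y) th'|)).
    by rewrite lerN2 lerDl ltW.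
  apply: le_trans (lerNnormlW _) _ => //.
  rewrite -ler_expR lnK ?posrE//.
  have := expR_le_partition_fun y th' (isometry_group1 G).
  by rewrite mul1mx.
apply: le_trans (_ : partition_fun G y th' <= _); last by rewrite lerDr.
by apply: le_trans (ltW (ln_sublinear Z0)) _.
Qed.

Lemma exp_bounded_ln_likelihood th v :
  exp_bounded (fun t y => ln (likelihood G (vec y) (th + t *: v))).
Proof.
pose c : R := ln (#|` G|%:R * (2 * pi) `^ (d%:R / 2))^-1.
(* The log-likelihood itself, with |y|^2 written through the coordinates <y, e_i> and |th + t v|^2
   expanded in one argument, so that every piece is already known to be bounded. *)
apply: (@exp_bounded_le _ _ _ (fun t y => c - (\sum_i dot (vec y) (delta_mx i 0) *
   dot (vec y) (delta_mx i 0)) / 2 + (ln (partition_fun G y (th + t *: v)) -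
   (dot (th + t *: v) th + t * dot (th + t *: v) v) / 2))).
  move=> t y _; rewrite ln_likelihoodE (dotDr _ th) dotZr -/c.
  rewrite (_ : \sum_i _ = dot (vec y) (vec y))//.
  apply: eq_bigr => i _; have dotE : dot (vec y) (delta_mx i 0) = vec y i 0.
    rewrite /dot (bigD1 i)//= big1 => [|j ji].
      by rewrite [delta_mx _ _ _ _]mxE !eqxx mulr1 addr0.
    by rewrite [delta_mx _ _ _ _]mxE (negbTE ji) mulr0.
  by rewrite dotE.
apply: exp_boundedD.
  apply: exp_boundedB; first exact: exp_bounded_cst.
  apply: exp_boundedM; last exact: exp_bounded_cst.
  by apply: exp_bounded_sum => i _; apply: exp_boundedM; exact: exp_bounded_dot.
apply: exp_boundedB; first exact: exp_bounded_ln_partition_fun.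
apply: exp_boundedM; last exact: exp_bounded_cst.
apply: exp_boundedD; first exact: exp_bounded_dot_param.
by apply: exp_boundedM; [exact: exp_bounded_id|exact: exp_bounded_dot_param].
Qed.

End fisher.

(** * Derivatives of Psi and the information identity *)

Section fisher_score.
Context {R : realType} {d : nat} (G : isometry_group R d) (th0 : 'cV[R]_d).
Local Notation Y := (d.-tuple (measurableTypeR R)).
Local Notation gamma := (gaussian (0 : 'cV[R]_d)).
Local Notation W := (mixture_density G th0).
Implicit Types (y : Y) (th u v : 'cV[R]_d) (g : 'M[R]_d).

Lemma PsiE th :
  Psi G th0 th = \int[gamma]_y (ln (likelihood G (vec y) th) * W y).
Proof.
rewrite /Psi unlock -Rintegral_mixture//; exact: measurable_ln_likelihood.
Qed.

Lemma is_derive_mulr (f : R -> R) (c t df : R) :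
  is_derive (t : R) (1 : R) f df ->
  is_derive (t : R) (1 : R) (fun s => f s * c) (df * c).
Proof. by move=> fE; apply: is_derive_eq; rewrite /GRing.scale/=; ring. Qed.

Lemma measurable_mixture_density : measurable_fun setT W.
Proof. by case: (tame_mixture_density G th0). Qed.

Lemma exp_bounded_mixture_density : exp_bounded (fun=> W).
Proof. by case: (tame_mixture_density G th0). Qed.

Lemma is_derive_ln_likelihood y th v (t : R) :
  is_derive (t : R) (1 : R)
    (fun s : R => ln (likelihood G (vec y) (th + s *: v)))
    (score G y (th + t *: v) v).
Proof.
have ZE := is_derive_ln_partition_fun G y th v t.
have QE : is_derive (t : R) (1 : R)
    (fun s : R => dot (th + s *: v) (th + s *: v) / 2) (dot (th + t *: v) v).
  rewrite (_ : (fun s => _) = (fun s : R => dot th th / 2 + s * dot th v +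
      s * s * (dot v v / 2))); last first.
    apply/funext => s; rewrite !(dotDl, dotDr) !(dotZl, dotZr) (dotC v th).
    by field.
  by apply: is_derive_eq; rewrite dotDl dotZl /GRing.scale/=; field.
pose c : R := ln (#|` G|%:R * (2 * pi) `^ (d%:R / 2))^-1 -
  dot (vec y) (vec y) / 2.
have := is_deriveD (is_derive_cst c t (1 : R)) (is_deriveB ZE QE).
rewrite add0r; congr (is_derive _ _ _ _); apply/funext => s.
by rewrite [RHS]ln_likelihoodE.
Qed.

Lemma derive_Psi th v :
  'D_v (Psi G th0) th = \int[gamma]_y (score G y th v * W y).
Proof.
apply: derive_line.
rewrite [X in is_derive _ _ X _](_ : _ = fun t : R =>
    \int[gamma]_y (ln (likelihood G (vec y) (th + t *: v)) * W y)); last first.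
  by apply/funext => t; exact: PsiE.
(* The base point is rewritten as [th + 0 *: v], so that the integrand is the value at t = 0 of the
   differentiated family. *)
rewrite [X in is_derive _ _ _ X](_ : _ =
    \int[gamma]_y (score G y (th + 0 *: v) v * W y)); last first.
  by rewrite scale0r addr0.
apply: (@is_derive_gaussian_integral _ _
  (fun t y => ln (likelihood G (vec y) (th + t *: v)) * W y)
  (fun t y => score G y (th + t *: v) v * W y)).
- move=> t; apply: measurable_funM; first exact: measurable_ln_likelihood.
  exact: measurable_mixture_density.
- by move=> t y; apply: is_derive_mulr; exact: is_derive_ln_likelihood.
- apply: exp_boundedM; first exact: exp_bounded_ln_likelihood.
  exact: exp_bounded_mixture_density.
- apply: exp_boundedM; first exact: exp_bounded_score.
  exact: exp_bounded_mixture_density.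
Qed.

Lemma derive2_Psi th u v :
  'D_u ('D_v (Psi G th0)) th = \int[gamma]_y ((\sum_(g <- G) posterior G y th g *
        (dot (vec y) (g *m u) - posterior_mean G y th u) *
        dot (vec y) (g *m v) - dot u v) * W y).
Proof.
apply: derive_line.
rewrite [X in is_derive _ _ X _](_ : _ = fun t : R =>
    \int[gamma]_y (score G y (th + t *: u) v * W y)); last first.
  by apply/funext => t; exact: derive_Psi.
pose ds y th := \sum_(g <- G) posterior G y th g *
        (dot (vec y) (g *m u) - posterior_mean G y th u) *
        dot (vec y) (g *m v) - dot u v.
rewrite [X in is_derive _ _ _ X](_ : _ =
    \int[gamma]_y (ds y (th + 0 *: u) * W y)); last by rewrite scale0r addr0.
apply: (@is_derive_gaussian_integral _ _
  (fun t y => score G y (th + t *: u) v * W y)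
  (fun t y => ds y (th + t *: u) * W y)).
- move=> t; apply: measurable_funM; first exact: measurable_score.
  exact: measurable_mixture_density.
- by move=> t y; apply: is_derive_mulr; exact: is_derive_score.
- apply: exp_boundedM; first exact: exp_bounded_score.
  exact: exp_bounded_mixture_density.
- apply: exp_boundedM; last exact: exp_bounded_mixture_density.
  apply: exp_boundedB; last exact: exp_bounded_cst.
  apply: exp_bounded_sum => g gG; apply: exp_boundedM; last exact: exp_bounded_dot.
  apply: exp_boundedM; first exact: exp_bounded_posterior.
  apply: exp_boundedB; first exact: exp_bounded_dot.
  exact: exp_bounded_posterior_mean.
Qed.

Lemma tame_posterior_mean th v : tame (fun y => posterior_mean G y th v).
Proof.
split; first exact: measurable_posterior_mean.
apply: exp_bounded_le (exp_bounded_posterior_mean G th 0 v) => t y _.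
by rewrite scaler0 addr0.
Qed.

Lemma tame_score th v : tame (fun y => score G y th v).
Proof. by apply: tameB; [exact: tame_posterior_mean|exact: tame_cst]. Qed.

Lemma tame_posterior th g : g \in (G : {fset 'M[R]_d}) ->
  tame (fun y => posterior G y th g).
Proof.
move=> gG; split; first exact: measurable_posterior.
apply: exp_bounded_le (exp_bounded_posterior th 0 gG) => t y _.
by rewrite scaler0 addr0.
Qed.

(* Bayes' formula: the posterior times the mixture is the joint density. *)
Lemma posterior_mixture_density y g :
  posterior G y th0 g * W y =
  #|` G|%:R^-1 * expR (- (dot th0 th0 / 2)) * expR (dot (vec y) (g *m th0)).
Proof.
have -> : W y = #|` G|%:R^-1 * expR (- (dot th0 th0 / 2)) *
    partition_fun G y th0.
  rewrite /mixture_density -mulrA; congr (_ * _); rewrite mulr_sumr.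
  by apply: eq_bigr => h _; rewrite -expRD addrC.
rewrite posteriorE mulrC -!mulrA; congr (_ * (_ * _)).
by rewrite mulrCA divff ?mulr1// gt_eqF// partition_fun_gt0.
Qed.

Lemma sum_posterior y th : \sum_(g <- G) posterior G y th g = 1.
Proof.
under eq_bigr do rewrite posteriorE.
by rewrite -mulr_suml divff// gt_eqF// partition_fun_gt0.
Qed.

(* The information identity: minus the expected Hessian of the log-likelihood
   is the covariance of the score. *)
Lemma derive2_Psi_score u v : - 'D_u ('D_v (Psi G th0)) th0 =
  \int[gamma]_y (score G y th0 u * score G y th0 v * W y).
Proof.
pose ds y := \sum_(g <- G) posterior G y th0 g *
    (dot (vec y) (g *m u) - posterior_mean G y th0 u) *
    dot (vec y) (g *m v) - dot u v.
have -> : 'D_u ('D_v (Psi G th0)) th0 = \int[gamma]_y (ds y * W y).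
  exact: derive2_Psi.
(* The claim becomes: the mean of the product of scores plus the second derivative [ds] of the
   log-likelihood is zero. *)
apply/eqP; rewrite eq_sym -subr_eq0 opprK addrC.
have tds : tame ds.
  apply: tameB; last exact: tame_cst.
  apply: tame_sum => g gG; apply: tameM; last exact: tame_dot.
  apply: tameM; first exact: tame_posterior.
  by apply: tameB; [exact: tame_dot|exact: tame_posterior_mean].
have tW := tame_mixture_density G th0.
have tss : tame (fun y => score G y th0 u * score G y th0 v * W y).
  by apply: tameM => //; apply: tameM; exact: tame_score.
rewrite -Rintegral_tameD//; last exact: tameM.
pose c : R := #|` G|%:R^-1 * expR (- (dot th0 th0 / 2)).
(* This is (<y, g u> - <th0, u>) (<y, g v> - <th0, v>) - <u, v>, expanded and multiplied by exp <y,
   g th0>. *)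
pose F g y : R := (dot (vec y) (g *m u) * dot (vec y) (g *m v)
      * expR (dot (vec y) (g *m th0)) +
    ((- dot th0 v) * (dot (vec y) (g *m u) * expR (dot (vec y) (g *m th0))) +
    ((- dot th0 u) * (dot (vec y) (g *m v) * expR (dot (vec y) (g *m th0))) +
    (dot th0 u * dot th0 v - dot u v) * expR (dot (vec y) (g *m th0))))).
have t1 g : tame (fun y => dot (vec y) (g *m u) * dot (vec y) (g *m v)
      * expR (dot (vec y) (g *m th0))).
  by apply: tameM (tame_expR_dot _); apply: tameM; exact: tame_dot.
have t2 g w : tame (fun y => dot (vec y) (g *m w) * expR (dot (vec y) (g *m th0))).
  by apply: tameM (tame_expR_dot _); exact: tame_dot.
have t3 g := @tame_expR_dot R d (g *m th0).
have tc (a : R) f : tame f -> tame (fun y => a * f y).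
  by move=> tf; apply: tameM tf; exact: tame_cst.
have tF g : tame (F g).
  apply: tameD => //; apply: tameD; first exact: tc.
  by apply: tameD; exact: tc.
rewrite (@eq_Rintegral _ _ _ _ _ (fun y => \sum_(g <- G) c * F g y)); last first.
  move=> y _.
  transitivity (\sum_(g <- G) posterior G y th0 g * W y *
     (dot (vec y) (g *m u) * dot (vec y) (g *m v) +
      ((- dot th0 v) * dot (vec y) (g *m u) +
      ((- dot th0 u) * dot (vec y) (g *m v) +
       (dot th0 u * dot th0 v - dot u v))))); last first.
    by apply: eq_bigr => g _; rewrite posterior_mixture_density /F /c; ring.
  rewrite /ds /score /posterior_mean.
  set P := posterior G y th0; set a := fun g => dot (vec y) (g *m u).
  set b := fun g => dot (vec y) (g *m v).
  have P1 : \sum_(g <- G) P g = 1 := sum_posterior y th0.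
  set A := \sum_(g <- G) P g * a g; set B := \sum_(g <- G) P g * b g.
  set D := \sum_(g <- G) P g * (a g * b g).
  have -> : \sum_(g <- G) P g * (a g - A) * b g = D - A * B.
    rewrite /D /B mulr_sumr -sumrB; apply: eq_bigr => g _; ring.
  (* The term - A B of the posterior covariance cancels the product of posterior means in the
     product of scores. What remains is linear in the posterior weights, so Bayes' formula turns
     each summand into a Gaussian integrand. *)
  transitivity (W y * (D + (- dot th0 v) * A + (- dot th0 u) * B +
     (dot th0 u * dot th0 v - dot u v) * \sum_(g <- G) P g)).
    by rewrite P1; ring.
  rewrite /D /A /B !mulr_sumr -!big_split/= mulr_sumr.
  by apply: eq_bigr => g _; rewrite /a /b; ring.
rewrite Rintegral_tame_sum => [|g _]; last exact: tc.
rewrite big_seq big1// => g gG.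
(* Each component contributes zero: under N(g th0, I) the covariance of <y, g u> and <y, g v> is <g
   u, g v> = <u, v>. *)
rewrite Rintegral_tameZ// !Rintegral_tameD//; do ?exact: tc.
- rewrite !Rintegral_tameZ// Rintegral_dot2_expR_dot !Rintegral_dot_expR_dot.
  by rewrite Rintegral_expR_dot !(dot_isometry gG); ring.
- by apply: tameD; exact: tc.
- by apply: tameD; [exact: tc|apply: tameD; exact: tc].
Qed.

Lemma fisherE i j : fisher G th0 i j = \int[gamma]_y
  (score G y th0 (delta_mx i 0) * score G y th0 (delta_mx j 0) * W y).
Proof. by rewrite !mxE derive2_Psi_score. Qed.

End fisher_score.

(** * Functions bounded by a multiple of 1/t *)

Section inverse_linear_decay.
Context {R : realType}.
Implicit Types f : R -> R.

(** A quantitative form of convergence to 0 at infinity: the final contradiction is reached at one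
    explicit [t]. *)
Definition decays f := exists K, forall t, 1 <= t -> `|f t| <= K / t.

Lemma decaysZ f c : decays f -> decays (fun t => c * f t).
Proof.
move=> [K fK]; exists (`|c| * K) => t t1.
by rewrite normrM -mulrA ler_wpM2l// fK.
Qed.

Lemma decays_sum (I : eqType) (s : seq I) (P : pred I) (F : I -> R -> R) :
  (forall i, i \in s -> P i -> decays (F i)) ->
  decays (fun t => \sum_(i <- s | P i) F i t).
Proof.
elim: s => [|i s ih] dF.
  by exists 0 => t t1; rewrite big_nil normr0 mul0r.
have [|K hK] := ih; first by move=> j js; apply: dF; rewrite inE js orbT.
case Pi : (P i); last by exists K => t t1; rewrite big_cons Pi; exact: hK.
have [L hL] := dF i (mem_head _ _) Pi.
exists (L + K) => t t1; rewrite big_cons Pi mulrDl.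
by apply: le_trans (ler_normD _ _) _; apply: lerD; [exact: hL|exact: hK].
Qed.

(** Squaring exp(x/2) >= 1 + x/2 gives exp x >= x^2/4. *)
Lemma sqr_le_expR (x : R) : 0 <= x -> x ^+ 2 <= 4 * expR x.
Proof.
move=> x0; have h : 1 + x / 2 <= expR (x / 2) by exact: expR_ge1Dx.
have -> : expR x = expR (x / 2) * expR (x / 2) by rewrite -expRD -splitr.
by have := expR_gt0 (x / 2); nra.
Qed.

(** The bound exp(-t e) <= 4/(t e)^2 against the linear growth of the affine factor leaves 1/t. *)
Lemma decays_affine_expR (a b c e : R) : 0 < e ->
  decays (fun t => (t * a + b) * expR (c - t * e)).
Proof.
move=> e0; exists ((`|a| + `|b|) * (expR c * (4 / e ^+ 2))) => t t1.
have t0 : 0 < t by exact: lt_le_trans t1.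
rewrite normrM (ger0_norm (expR_ge0 _)) expRD.
have h1 : `|t * a + b| <= (`|a| + `|b|) * t.
  apply: le_trans (ler_normD _ _) _; rewrite normrM (gtr0_norm t0) mulrDl.
  by rewrite (mulrC t) lerD2l ler_peMr.
have h2 : expR (- (t * e)) <= 4 / e ^+ 2 / t ^+ 2.
  rewrite expRN !ler_pdivlMr ?exprn_gt0// -mulrA ler_pdivrMl ?expR_gt0//.
  rewrite -exprMn (mulrC _ 4).
  by apply: sqr_le_expR; rewrite mulr_ge0 ?ltW.
have h3 : 0 <= expR c * expR (- (t * e)) by rewrite mulr_ge0 ?expR_ge0.
apply: le_trans (ler_pM (normr_ge0 _) h3 h1 (ler_wpM2l (expR_ge0 c) h2)) _.
rewrite le_eqVlt; apply/orP; left; apply/eqP; field.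
by rewrite !gt_eqF.
Qed.

End inverse_linear_decay.

(** * The Fisher quadratic form and its definiteness *)

Section fisher_definite.
Context {R : realType} {d : nat} (G : isometry_group R d) (th0 : 'cV[R]_d).
Local Notation Y := (d.-tuple (measurableTypeR R)).
Local Notation gamma := (gaussian (0 : 'cV[R]_d)).
Local Notation W := (mixture_density G th0).
Local Notation s x y := (score G y th0 x).
Implicit Types (y : Y) (u v x z : 'cV[R]_d) (g : 'M[R]_d).

Lemma scoreD y u v : s (u + v) y = s u y + s v y.
Proof.
rewrite /score /posterior_mean dotDr addrACA -opprD; congr (_ - _).
by rewrite -big_split/=; apply: eq_bigr => g _; rewrite mulmxDr dotDr mulrDr.
Qed.

Lemma scoreZ y (a : R) u : s (a *: u) y = a * s u y.
Proof.
rewrite /score /posterior_mean dotZr mulrBr; congr (_ - _).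
by rewrite mulr_sumr; apply: eq_bigr => g _; rewrite -scalemxAr dotZr mulrCA.
Qed.

Lemma score_sum y I (r : seq I) (P : pred I) (F : I -> 'cV[R]_d) :
  s (\sum_(i <- r | P i) F i) y = \sum_(i <- r | P i) s (F i) y.
Proof.
apply: (big_morph (fun v => s v y)) => [u v|]; first exact: scoreD.
by rewrite -(scale0r 0) scoreZ mul0r.
Qed.

Lemma score_delta y x : s x y = \sum_i x i 0 * s (delta_mx i 0) y.
Proof.
rewrite {1}[x]matrix_sum_delta score_sum; apply: eq_bigr => i _.
by rewrite big_ord1 scoreZ.
Qed.

Lemma fisher_quadratic x : (x^T *m fisher G th0 *m x) 0 0 =
  \int[gamma]_y (s x y ^+ 2 * W y).
Proof.
have tW := tame_mixture_density G th0.
pose F i j y : R := x i 0 * x j 0 * (s (delta_mx i 0) y * s (delta_mx j 0) y * W y).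
have tF0 i j : tame (fun y => s (delta_mx i 0) y * s (delta_mx j 0) y * W y).
  by apply: tameM => //; apply: tameM; exact: tame_score.
have tF i j : tame (F i j) by apply: tameM => //; exact: tame_cst.
rewrite (@eq_Rintegral _ _ _ _ _ (fun y => \sum_j \sum_i F i j y)); last first.
  move=> y _; rewrite expr2 score_delta mulr_sumr mulr_suml; apply: eq_bigr => j _.
  by rewrite !mulr_suml; apply: eq_bigr => i _; rewrite /F; ring.
rewrite Rintegral_tame_sum => [|j _]; last by apply: tame_sum.
rewrite mxE; apply: eq_bigr => j _; rewrite Rintegral_tame_sum//.
rewrite mxE mulr_suml; apply: eq_bigr => i _.
by rewrite Rintegral_tameZ// fisherE [x^T _ _]mxE mulrAC.
Qed.

Lemma fisher_sym : (fisher G th0)^T = fisher G th0.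
Proof.
apply/matrixP => i j; rewrite mxE !fisherE.
by apply: eq_Rintegral => y _; rewrite (mulrC (score _ _ _ _)).
Qed.

Lemma fisher_quadratic_ge0 x : 0 <= (x^T *m fisher G th0 *m x) 0 0.
Proof.
rewrite fisher_quadratic; apply: Rintegral_ge0 => y _.
by rewrite mulr_ge0 ?sqr_ge0// mixture_density_ge0.
Qed.

(** Right multiplication by the invertible [k] is an injective self-map of a finite set, hence a
    bijection. *)
Lemma perm_isometries k : k \in (G : {fset 'M[R]_d}) ->
  perm_eq [seq g *m k | g <- G] G.
Proof.
move=> kG.
have U : uniq [seq g *m k | g <- G].
  rewrite map_inj_uniq ?fset_uniq// => g h.
  by move/(congr1 (mulmx^~ (invmx k))); rewrite !mulmxK// (isometry_unitmx kG).
apply: uniq_perm => //; first exact: fset_uniq.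
have sub : {subset [seq g *m k | g <- G] <= (G : {fset 'M[R]_d})}.
  by move=> _ /mapP[g gG ->]; exact: isometry_groupM.
by have [] := uniq_min_size U sub; rewrite ?size_map.
Qed.

(* The components [g] and [g k] have the same posterior, so that reindexing by
   [g -> g k] identifies the posterior means in the directions [w] and [k w]. *)
Lemma score_fixed k w y : k \in (G : {fset 'M[R]_d}) -> k *m th0 = th0 ->
  s (w - k *m w) y = 0.
Proof.
move=> kG kth; rewrite scoreD -scaleN1r scoreZ mulN1r /score.
(* Since k th0 = th0, <th0, k w> = <k th0, k w> = <th0, w>, so the linear terms of the two scores
   agree. *)
rewrite -[in dot th0 (k *m w)]kth (dot_isometry kG).
rewrite /posterior_mean -[X in X - _ - _](perm_big _ (perm_isometries kG))/=.
rewrite big_map; apply/eqP; rewrite subr_eq0; apply/eqP; congr (_ - _).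
by apply: eq_bigr => g _; rewrite /posterior -!mulmxA kth.
Qed.

(* Discriminant of the nonnegative quadratic [e |-> E (s + e h)^2]. *)
Lemma score_orthogonal x (h : Y -> R) :
  \int[gamma]_y (s x y ^+ 2 * W y) = 0 -> tame h ->
  \int[gamma]_y (h y * (s x y * W y)) = 0.
Proof.
move=> s0 th; have tW := tame_mixture_density G th0.
have ts : tame (fun y => s x y) by exact: tame_score.
have tsW : tame (fun y => s x y ^+ 2 * W y).
  by apply: tameM => //; exact: tameM.
have thW : tame (fun y => h y ^+ 2 * W y).
  by apply: tameM => //; exact: tameM.
have thsW : tame (fun y => h y * (s x y * W y)).
  by apply: tameM => //; exact: tameM.
set a := LHS; set b := \int[gamma]_y (h y ^+ 2 * W y).
have b0 : 0 <= b.
  apply: Rintegral_ge0 => y _.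
  by rewrite mulr_ge0 ?sqr_ge0// mixture_density_ge0.
have q (e : R) : 0 <= 2 * e * a + e ^+ 2 * b.
  have : 0 <= \int[gamma]_y ((s x y + e * h y) ^+ 2 * W y).
    apply: Rintegral_ge0 => y _.
    by rewrite mulr_ge0 ?sqr_ge0// mixture_density_ge0.
  rewrite (@eq_Rintegral _ _ _ _ _ (fun y => s x y ^+ 2 * W y +
      (2 * e * (h y * (s x y * W y)) + e ^+ 2 * (h y ^+ 2 * W y)))); last first.
    by move=> y _; ring.
  have tc (c : R) f : tame f -> tame (fun y => c * f y).
    by move=> tf; apply: tameM tf; exact: tame_cst.
  rewrite !Rintegral_tameD//; do ?exact: tc.
    by rewrite s0 add0r !Rintegral_tameZ.
  by apply: tameD; exact: tc.
have b1 : 0 < b + 1 by rewrite ltr_wpDl.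
(* A near-minimizer of the quadratic; b + 1 replaces [b], which may be 0. The value there is -a^2 (b
   + 2)/(b + 1)^2, so its nonnegativity forces a = 0. *)
have := q (- a / (b + 1)).
have -> : 2 * (- a / (b + 1)) * a + (- a / (b + 1)) ^+ 2 * b =
    - (a ^+ 2 * (b + 2) / (b + 1) ^+ 2) by field; rewrite gt_eqF.
rewrite oppr_ge0 pmulr_lle0 ?invr_gt0 ?exprn_gt0// pmulr_lle0 ?ltr_wpDl//.
by move=> a2; apply/eqP; rewrite -sqrf_eq0 eq_le a2 sqr_ge0.
Qed.

(* Testing the score against [exp <y, z>], whose moments are explicit. *)
Lemma degenerate_sum x z : \int[gamma]_y (s x y ^+ 2 * W y) = 0 ->
  \sum_(g <- G) dot z (g *m x) * expR (dot z (g *m th0)) = 0.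
Proof.
move=> /score_orthogonal /(_ (tame_expR_dot z)).
pose c : R := #|` G|%:R^-1 * expR (- (dot th0 th0 / 2)).
have tc (a : R) f : tame f -> tame (fun y => a * f y).
  by move=> tf; apply: tameM tf; exact: tame_cst.
have t1 g : tame (fun y => dot (vec y) (g *m x) * expR (dot (vec y) (g *m th0 + z))).
  by apply: tameM (tame_expR_dot _); exact: tame_dot.
have t2 g := @tame_expR_dot R d (g *m th0 + z).
have tF g : tame (fun y => dot (vec y) (g *m x) * expR (dot (vec y) (g *m th0 + z)) +
      (- dot th0 x) * expR (dot (vec y) (g *m th0 + z))).
  by apply: tameD => //; exact: tc.
rewrite (@eq_Rintegral _ _ _ _ _ (fun y => \sum_(g <- G) c *
    (dot (vec y) (g *m x) * expR (dot (vec y) (g *m th0 + z)) +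
     (- dot th0 x) * expR (dot (vec y) (g *m th0 + z))))); last first.
  move=> y _.
  transitivity (\sum_(g <- G) expR (dot (vec y) z) * (posterior G y th0 g * W y) *
      (dot (vec y) (g *m x) - dot th0 x)); last first.
    apply: eq_bigr => g _; rewrite posterior_mixture_density dotDr expRD /c; ring.
  rewrite /score /posterior_mean -[dot th0 x in LHS]mul1r -(sum_posterior G y th0).
  rewrite mulr_suml -sumrB mulr_suml mulr_sumr.
  by apply: eq_bigr => g _; ring.
rewrite Rintegral_tame_sum => [|g _]; last exact: tc.
(* The moments are taken at g th0 + z. The first one, <g th0 + z, g x>, loses <th0, x> and becomes
   <z, g x>; half the squared norm of g th0 + z is a part common to all [g] plus <z, g th0>. *)
rewrite (_ : \sum_(g <- G) _ = c * expR ((dot th0 th0 + dot z z) / 2) *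
    \sum_(g <- G) dot z (g *m x) * expR (dot z (g *m th0))).
  move/eqP; rewrite mulf_eq0 => /orP[|/eqP//].
  rewrite gt_eqF// !mulr_gt0 ?expR_gt0// invr_gt0; exact: card_isometries_gt0.
rewrite mulr_sumr !big_seq; apply: eq_bigr => g gG.
rewrite Rintegral_tameZ// Rintegral_tameD//; last exact: tc.
rewrite Rintegral_tameZ// Rintegral_dot_expR_dot Rintegral_expR_dot.
have -> : dot (g *m th0 + z) (g *m th0 + z) / 2 =
    (dot th0 th0 + dot z z) / 2 + dot z (g *m th0).
  rewrite !(dotDl, dotDr) (dot_isometry gG) (dotC (g *m th0) z).
  by field.
rewrite dotDl (dot_isometry gG) expRD; ring.
Qed.

Hypothesis free_orbit : forall g h, g \in (G : {fset 'M[R]_d}) ->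
  h \in (G : {fset 'M[R]_d}) -> g *m th0 = h *m th0 -> g = h.

(* Evaluating [degenerate_sum] at [z = t th0 + x], the term of the identity
   dominates the others as [t] goes to infinity. *)
Lemma degenerate_decays x : \int[gamma]_y (s x y ^+ 2 * W y) = 0 ->
  decays (fun t => t * dot th0 x + dot x x).
Proof.
move=> s0.
(* As |g th0| = |th0|, this gap is |th0 - g th0|^2/2, positive because the centers are distinct. *)
have gap g : g \in (G : {fset 'M[R]_d}) -> g != 1%:M ->
    0 < dot th0 th0 - dot th0 (g *m th0).
  move=> gG g1; have : 0 < dot (th0 - g *m th0) (th0 - g *m th0).
    rewrite lt_neqAle dot_ge0 andbT eq_sym; apply: contra_neq g1 => /dot_eq0 /eqP.
    rewrite subr_eq0 => /eqP E; apply: free_orbit => //.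
      exact: isometry_group1.
    by rewrite mul1mx.
  rewrite !(dotDl, dotDr, dotNl, dotNr) (dot_isometry gG) (dotC _ th0); lra.
(* The term of [g] at z = t th0 + x, rescaled by exp(-t |th0|^2): it decays for g != 1, while for g
   = 1 the exponential is the constant exp <x, th0>. *)
pose r g t : R := (t * dot th0 (g *m x) + dot x (g *m x)) *
   expR (dot x (g *m th0) - t * (dot th0 th0 - dot th0 (g *m th0))).
have dr : decays (fun t => (- expR (- dot x th0)) * \sum_(g <- G | g != 1%:M) r g t).
  apply: decaysZ; apply: decays_sum => g gG g1.
  exact: decays_affine_expR (gap g gG g1).
case: dr => K hK; exists K => t t1.
suff -> : t * dot th0 x + dot x x =
    (- expR (- dot x th0)) * \sum_(g <- G | g != 1%:M) r g t by exact: hK.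
have r0 : \sum_(g <- G) r g t = 0.
  transitivity (expR (- (t * dot th0 th0)) * \sum_(g <- G)
      dot (t *: th0 + x) (g *m x) * expR (dot (t *: th0 + x) (g *m th0))).
    rewrite mulr_sumr; apply: eq_bigr => g _.
    by rewrite /r !(dotDl, dotZl) mulrCA -expRD; congr (_ * expR _); ring.
  by rewrite degenerate_sum// mulr0.
move: r0; rewrite (bigD1_seq 1%:M) ?fset_uniq ?isometry_group1//=.
rewrite /r !mul1mx subrr mulr0 subr0 -/r => /eqP; rewrite addr_eq0 => /eqP r0.
by rewrite mulNr -mulrN -r0 mulrCA -expRD addNr expR0 mulr1.
Qed.

Lemma fisher_quadratic_gt0 x : x != 0 -> 0 < (x^T *m fisher G th0 *m x) 0 0.
Proof.
move=> x0; rewrite lt_neqAle fisher_quadratic_ge0 andbT.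
apply: contra_neq x0 => /esym; rewrite fisher_quadratic => s0.
(* The direction -x is degenerate too; adding the two decay estimates cancels the terms in t <th0,
   x> and leaves 2 |x|^2 <= (K + L)/t. *)
have s1 : \int[gamma]_y (s (- x) y ^+ 2 * W y) = 0.
  rewrite -[RHS]s0; apply: eq_Rintegral => y _.
  by rewrite -scaleN1r scoreZ mulN1r sqrrN.
have [K hK] := degenerate_decays s0; have [L hL] := degenerate_decays s1.
have KL t : 1 <= t -> 2 * dot x x <= (K + L) / t.
  move=> t1; have := hK t t1; have := hL t t1.
  rewrite dotNr dotNl dotNr opprK mulrN mulrDl => h1 h2.
  have := ler_norm (- (t * dot th0 x) + dot x x).
  have := ler_norm (t * dot th0 x + dot x x); lra.
apply: dot_eq0; apply/eqP; rewrite eq_le dot_ge0 andbT leNgt; apply/negP => q0.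
have KL0 : 0 <= K + L.
  by have := KL 1 (lexx _); rewrite divr1; apply: le_trans; rewrite mulr_ge0 ?dot_ge0.
(* At this [t], 2 |x|^2 t equals 2 |x|^2 + 2 (K + L), which exceeds K + L: a contradiction. *)
have T1 : 1 <= 1 + (K + L) / dot x x by rewrite lerDl divr_ge0// ltW.
have qT : 2 * dot x x * (1 + (K + L) / dot x x) = 2 * dot x x + 2 * (K + L).
  by field; rewrite gt_eqF.
have := KL _ T1; rewrite ler_pdivlMr ?(lt_le_trans ltr01 T1)//.
move: qT KL0 q0; lra.
Qed.

End fisher_definite.

(** * Degenerate directions from a stabilizer, and the equivalence *)

(** The score in the direction w - k w vanishes at every [y], so its mean square is zero. *)
Lemma fisher_degenerate (R : realType) (d : nat) (G : isometry_group R d)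
    (th0 w : 'cV[R]_d) (k : 'M[R]_d) :
  k \in (G : {fset 'M[R]_d}) -> k *m th0 = th0 ->
  ((w - k *m w)^T *m fisher G th0 *m (w - k *m w)) 0 0 = 0.
Proof.
move=> kG kth; rewrite fisher_quadratic (@eq_Rintegral _ _ _ _ _ (cst 0)).
  by rewrite Rintegral_cst// mul0r.
by move=> y _; rewrite score_fixed// expr0n mul0r.
Qed.

Unset Implicit Arguments.

Theorem corollary1 (R : realType) (d : nat) (hd : (0 < d)%N)
    (G : isometry_group R d) (theta0 : 'cV[R]_d) :
  posdefmx (fisher G theta0) <->
  (forall g h : 'M[R]_d, g \in (G : {fset 'M[R]_d}) ->
     h \in (G : {fset 'M[R]_d}) -> g *m theta0 = h *m theta0 -> g = h).
Proof.
split=> [[_ posI] g h gG hG gh|free]; last first.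
  by split; [exact: fisher_sym|move=> x; exact: fisher_quadratic_gt0].
have gU := isometry_unitmx gG.
pose k := invmx g *m h.
have kG : k \in (G : {fset 'M[R]_d}).
  by apply: isometry_groupM => //; exact: isometry_groupV.
have kth : k *m theta0 = theta0 by rewrite /k -mulmxA -gh mulKmx.
suff k1 : k = 1%:M by rewrite -[LHS]mulmx1 -k1 mulKVmx.
(* Definiteness leaves no nonzero degenerate direction, so w - k w = 0 for all [w]; basis vectors
   then give k = 1. *)
have fixk (w : 'cV[R]_d) : k *m w = w.
  apply/eqP/negPn/negP => kw.
  have := posI (w - k *m w); rewrite (fisher_degenerate w kG kth) ltxx.
  by rewrite subr_eq0 eq_sym kw => /(_ isT).
apply/matrixP => i j; have := congr1 (fun w : 'cV[R]_d => w i 0) (fixk (delta_mx j 0)).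
by rewrite -colE !mxE eqxx andbT.
Qed.
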